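(* Let $m\in\mathbb Z\setminus\{0\}$ and $\xi\in\mathbb Z_m$. Then $\widetilde{BS}(m,\xi)$ is hopfian (every surjective endomorphism is injective) but not co-hopfian (there is an injective endomorphism which is not surjective).
   Context: $\mathbb Z_m$ is the ring of $m$-adic integers. The functions $r_i$: $r_0(\xi)=0$, $s_0(\xi)=1$, and for $i\ge1$, $r_i(\xi)\in\{0,\dots,|m|-1\}$, $s_i(\xi)\in\mathbb Z_m$ unique with $\xi s_{i-1}(\xi)=ms_i(\xi)+r_i(\xi)$. Let $E$ be the free abelian group with basis $e_0,e_1,\dots$, $E_{m,\xi}\le E$ with basis $me_0,\ e_i-r_i(\xi)e_0$ ($i\ge1$), $E_1\le E$ with basis $e_1,e_2,\dots$, and $\phi:E_{m,\xi}\to E_1$ the isomorphism $\phi(me_0)=e_1$, $\phi(e_i-r_i(\xi)e_0)=e_{i+1}$. $\widetilde{BS}(m,\xi)=\langle E,a\mid axa^{-1}=\phi(x)\ \forall x\in E_{m,\xi}\rangle$ (HNN extension). *)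

(* Defs.v *)
From HB Require Import structures.
From mathcomp Require Import all_boot all_order all_algebra.
Set Implicit Arguments. Unset Strict Implicit. Unset Printing Implicit Defensive.
Import Order.TTheory GRing.Theory Num.Theory.
Local Open Scope ring_scope.

(** * m-adic integers
    An element of Z_m = lim Z/|m|^k Z is represented by its compatible
    sequence of normalised residues x k in [0, |m|^k). *)
Definition padic (m : int) (x : nat -> int) : Prop :=
  forall k : nat, 0 <= x k < `|m| ^+ k /\
                  (x k.+1 == x k %[mod `|m| ^+ k])%Z.

(** The functions r_i, s_i of xi : r 0 = 0, s 0 = 1, and for i >= 1,
    r_i in {0,..,|m|-1}, s_i in Z_m with  xi * s_{i-1} = m * s_i + r_i
    (equality in Z_m, i.e. modulo |m|^k for every k). *)
Definition rs_spec (m : int) (xi r : nat -> int) (s : nat -> nat -> int) : Prop :=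
  [/\ r 0%N = 0,
      (forall k, (s 0%N k == 1 %[mod `|m| ^+ k])%Z),
      (forall i, padic m (s i)) &
      (forall i : nat, 0 <= r i.+1 < `|m| /\
         forall k, (xi k * s i k == m * s i.+1 k + r i.+1 %[mod `|m| ^+ k])%Z)].

Inductive gen : Type := GA | GE of nat.
Definition letter := (gen * bool)%type.   (* true = inverse letter *)
Definition word := seq letter.

Definition inv_letter (l : letter) : letter := (l.1, ~~ l.2).
Definition inv_word (w : word) : word := rev (map inv_letter w).
Definition pow_word (w : word) (z : int) : word :=
  match z with
  | Posz n => flatten (nseq n w)
  | Negz n => flatten (nseq n.+1 (inv_word w))
  end.

Definition wa : word := [:: (GA, false)].
Definition we (i : nat) : word := [:: (GE i, false)].

(** Relators of the presentation of the HNN extension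
    BS~(m,xi) = < E, a | a x a^-1 = phi(x), x in E_{m,xi} >,
    where E is free abelian on e_0, e_1, ...:
    - [e_i, e_j] (E abelian),
    - a (m e_0) a^-1 = e_1,
    - a (e_i - r_i e_0) a^-1 = e_{i+1} for i >= 1
    (it suffices to impose the HNN relations on a basis of E_{m,xi}). *)
Inductive relator (m : int) (r : nat -> int) : word -> Prop :=
| rel_comm i j : relator m r (we i ++ we j ++ inv_word (we i) ++ inv_word (we j))
| rel_base : relator m r (wa ++ pow_word (we 0) m ++ inv_word wa ++ inv_word (we 1))
| rel_step i : (1 <= i)%N ->
    relator m r (wa ++ we i ++ pow_word (we 0) (- r i) ++ inv_word wa
                    ++ inv_word (we i.+1)).

Inductive wequiv (m : int) (r : nat -> int) : word -> word -> Prop :=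
| weq_refl w : wequiv m r w w
| weq_sym u v : wequiv m r u v -> wequiv m r v u
| weq_trans u v w : wequiv m r u v -> wequiv m r v w -> wequiv m r u w
| weq_free u v l : wequiv m r (u ++ l :: inv_letter l :: v) (u ++ v)
| weq_rel u v R : relator m r R -> wequiv m r (u ++ R ++ v) (u ++ v).

Definition is_endo (m : int) (r : nat -> int) (f : word -> word) : Prop :=
  (forall u v, wequiv m r u v -> wequiv m r (f u) (f v)) /\
  (forall u v, wequiv m r (f (u ++ v)) (f u ++ f v)).

Definition endo_surjective (m : int) (r : nat -> int) (f : word -> word) : Prop :=
  forall y, exists x, wequiv m r (f x) y.

Definition endo_injective (m : int) (r : nat -> int) (f : word -> word) : Prop :=
  forall x y, wequiv m r (f x) (f y) -> wequiv m r x y.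

Definition BSt_hopfian (m : int) (r : nat -> int) : Prop :=
  forall f, is_endo m r f -> endo_surjective m r f -> endo_injective m r f.

Definition BSt_not_cohopfian (m : int) (r : nat -> int) : Prop :=
  exists f, [/\ is_endo m r f, endo_injective m r f & ~ endo_surjective m r f].

(* Main.v *)
(** The group G = BS~(m,xi) acts on the Bass-Serre tree of the HNN extension, and
    maps onto the wreath product Z wr Z by sending a to the shift and E injectively
    onto a subgroup of Z[t].

    Not co-hopfian: x |-> (|m|+1) x on E, a |-> a respects E_{m,xi} and E_1 in both
    directions because |m|+1 is prime to m, so it preserves reduced forms; it is
    injective, and e_0 is not in its image.

    Hopfian: let F be a surjective endomorphism, h = F(e_0), g = F(a).
    - The relation [e_0, a e_0^m a^-1] = 1 and surjectivity onto Z wr Z force h to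
      have a-exponent 0 and g to have a-exponent 1 or -1.
    - h is elliptic. Otherwise consider the components of the part of the tree below
      a given height that h stabilises. Elements of a-exponent 0 commuting with h
      stabilise them too, and since g h^m g^-1 commutes with h, the element h would
      also stabilise a component of smaller height, and so on indefinitely; but the
      translation length of h bounds these heights from below.
    - So h is conjugate into E; surjectivity onto Z wr Z makes its image a unit of
      Z[t, 1/t], hence h is conjugate to e_0 or its inverse. Replacing F by the square
      of a conjugate, F(e_0) = e_0 and g has a-exponent 1.
    - If |m| = 1, elements of a-exponent 0 are elliptic and the image in Z wr Z shows
      that F is injective. If |m| > 1, then E is the centraliser of e_0 and the image
      in Z wr Z shows that F is the identity on E. Then g^-1 does not move the base
      vertex v upwards, and an induction on reduced forms shows that F maps every
      reduced word of maximal height 0 and nonzero length outside E. *)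
Require Import Defs.
From HB Require Import structures.
From mathcomp Require Import all_boot all_order all_algebra.
From mathcomp Require Import boolp.
From mathcomp Require Import ring zify.
Set Implicit Arguments. Unset Strict Implicit. Unset Printing Implicit Defensive.
Import Order.TTheory GRing.Theory Num.Theory.
Local Open Scope quotient_scope.
Local Open Scope ring_scope.

(** * Linear maps out of the free abelian group E *)

Section LinearExtension.
Variables (V : zmodType) (c : nat -> V).

Definition lin_ext (y : {poly int}) : V := \sum_(i < size y) c i *~ y`_i.

Lemma lin_extE n (y : {poly int}) : (size y <= n)%N ->
  lin_ext y = \sum_(i < n) c i *~ y`_i.
Proof.
move=> le_yn; rewrite /lin_ext.
rewrite (big_ord_widen n (fun i : nat => c i *~ y`_i) le_yn) big_mkcond /=.
apply: eq_bigr => i _; case: ltnP => // le_yi.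
by rewrite nth_default.
Qed.

Lemma lin_extD y z : lin_ext (y + z) = lin_ext y + lin_ext z.
Proof.
rewrite !(@lin_extE (maxn (size y) (size z))) ?leq_maxl ?leq_maxr ?size_polyD //.
by rewrite -big_split; apply: eq_bigr => i _; rewrite coefD mulrzDr.
Qed.

Lemma lin_extN y : lin_ext (- y) = - lin_ext y.
Proof.
rewrite /lin_ext size_polyN -sumrN.
by apply: eq_bigr => i _; rewrite coefN mulrNz.
Qed.

Lemma lin_extC k : lin_ext k%:P = c 0 *~ k.
Proof. by rewrite (@lin_extE 1) ?size_polyC_leq1 // big_ord1 coefC. Qed.

Lemma lin_ext0 : lin_ext 0 = 0.
Proof. by rewrite /lin_ext size_poly0 big_ord0. Qed.

Lemma lin_extXn n : lin_ext 'X^n = c n.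
Proof.
rewrite /lin_ext size_polyXn (bigD1 ord_max) //= coefXn eqxx big1 ?addr0 //.
by move=> i ne_i; rewrite coefXn -val_eqE /= in ne_i *; rewrite (negbTE ne_i).
Qed.

End LinearExtension.

Lemma poly_int_ind (P : {poly int} -> Prop) :
  P 0 -> (forall n y, P y -> P (y + 'X^n)) -> (forall n y, P y -> P (y - 'X^n)) ->
  forall y, P y.
Proof.
move=> P0 PD PB y.
have PZ n k z : P z -> P (z + k *: 'X^n).
  move=> Pz; elim/int_rect: k => [|k IH|k IH]; first by rewrite scale0r addr0.
    by rewrite intS [1 + _]addrC scalerDl scale1r addrA; apply: PD.
  by rewrite intS opprD [- 1 + _]addrC scalerDl scaleN1r addrA; apply: PB.
rewrite -(coefK y) poly_def.
elim: (size y) => [|n IH]; first by rewrite big_ord0.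
rewrite big_ord_recr /=; exact: PZ.
Qed.

(** * The base group and its associated subgroups *)

(* The base group E is encoded as the additive group [{poly int}], with e_i = ['X^i].
   Signs of letters follow the convention of [letter]: [false] is a, [true] is a^-1. *)
Section Base.
Variables (m : int) (r : nat -> int).

(* E_{m,xi} is the kernel of [lam] modulo m. *)
Definition lam (y : {poly int}) : int :=
  lin_ext (fun i => if i is 0 then 1 else r i) y.

(** In the basis m e_0, e_i - r_i e_0 of E_{m,xi}, the coordinates of y are [lam y / m] and the y_i
    with i >= 1. So the constant coefficient is replaced by [lam y / m] before the shift; outside
    E_{m,xi} the rounded quotient is a junk value. *)
Definition phi (y : {poly int}) : {poly int} :=
  'X * (((lam y %/ m)%Z - y`_0)%:P + y).
(** The inverse isomorphism on E_1, extended to an additive map on all of E that ignores the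
    constant coefficient. *)
Definition psi (y : {poly int}) : {poly int} :=
  let u := drop_poly 1 y in u + (m * u`_0 - lam u)%:P.

(* [pin e y] says that a^e y a^-e lies in E; it is then [tr e y]. *)
Definition pin (e : bool) (y : {poly int}) : bool :=
  if e then y`_0 == 0 else (m %| lam y)%Z.
Definition tr (e : bool) : {poly int} -> {poly int} := if e then psi else phi.
(* Representative of the coset of y modulo the subgroup that moves across a^e. *)
Definition rep (e : bool) (y : {poly int}) : int :=
  if e then (lam y %% m)%Z else y`_0.

Lemma lamD y z : lam (y + z) = lam y + lam z. Proof. exact: lin_extD. Qed.
Lemma lamN y : lam (- y) = - lam y. Proof. exact: lin_extN. Qed.
Lemma lamC k : lam k%:P = k.
Proof. by rewrite /lam lin_extC /= intz. Qed.

Lemma pinD e y z : pin e y -> pin e z -> pin e (y + z).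
Proof.
case: e; rewrite /pin; last by rewrite lamD; apply: rpredD.
by rewrite coefD => /eqP-> /eqP->.
Qed.

Lemma pinN e y : pin e (- y) = pin e y.
Proof. by case: e; rewrite /pin ?coefN ?oppr_eq0 // lamN rpredN. Qed.

Lemma pin0 e : pin e 0.
Proof. by case: e; rewrite /pin ?coef0 // /lam lin_ext0 dvdz0. Qed.

Hypothesis m0 : m != 0.

Lemma rep_addl e c y : pin (~~ e) c -> rep e (c + y) = rep e y.
Proof.
case: e; rewrite /rep /pin /=; last by rewrite coefD => /eqP->; rewrite add0r.
by rewrite lamD => /dvdz_mod0P cm; rewrite -modzDml cm add0r.
Qed.

Lemma pin_rep e y : pin (~~ e) (y - (rep e y)%:P).
Proof.
case: e; rewrite /pin /rep /=; last by rewrite coefB coefC subrr.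
by rewrite lamD lamN lamC -eqz_mod_dvd modz_mod.
Qed.

Lemma rep0 e : rep e 0 = 0.
Proof. by case: e; rewrite /rep ?coef0 // /lam lin_ext0 mod0z. Qed.

Lemma rep_eq0 e y : (rep e y == 0) = pin (~~ e) y.
Proof. by case: e => //; apply/(sameP eqP)/dvdz_mod0P. Qed.

Lemma rep_addr e y z : rep e (y + (rep e z)%:P) = rep e (y + z).
Proof.
have -> : y + z = (z - (rep e z)%:P) + (y + (rep e z)%:P) by ring.
by rewrite rep_addl // pin_rep.
Qed.

Lemma rep_rep e y : rep e (rep e y)%:P = rep e y.
Proof. by have:= rep_addr e 0 y; rewrite !add0r. Qed.

Lemma coef0_psi y : (psi y)`_0 = y`_1 + (m * y`_1 - lam (drop_poly 1 y)).
Proof. by rewrite /psi coefD coefC /= !coef_drop_poly. Qed.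

Lemma lam_psi y : lam (psi y) = m * y`_1.
Proof. by rewrite /psi lamD lamC coef_drop_poly /=; ring. Qed.

Lemma pin_tr e y : pin e y -> pin (~~ e) (tr e y).
Proof.
case: e; rewrite /pin /tr /=; first by rewrite lam_psi dvdz_mulr.
by rewrite /phi coefXM.
Qed.

Lemma drop1_XM (u : {poly int}) : drop_poly 1 ('X * u) = u.
Proof. by apply/polyP => i; rewrite coef_drop_poly coefXM addn1. Qed.

Lemma trK e y : pin e y -> tr (~~ e) (tr e y) = y.
Proof.
case: e; rewrite /pin /tr /=.
  move/eqP=> y0; rewrite /phi lam_psi coef0_psi [m * y`_1]mulrC mulzK //.
  apply/polyP => -[|i]; first by rewrite coefXM y0.
  rewrite coefXM /= /psi !coefD !coefC coef_drop_poly addn1 /= !coef_drop_poly.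
  by case: i => [|i] /=; rewrite ?addn1; ring.
move=> dv; rewrite /psi /phi drop1_XM coefD coefC /= lamD lamC.
have -> : m * ((lam y %/ m)%Z - y`_0 + y`_0) = lam y by rewrite subrK mulrC divzK.
have -> : (lam y - ((lam y %/ m)%Z - y`_0 + lam y))%:P = - ((lam y %/ m)%Z - y`_0)%:P.
  by rewrite -polyCN; congr (_ %:P); ring.
by rewrite addrAC subrr add0r.
Qed.

Lemma psiD y z : psi (y + z) = psi y + psi z.
Proof.
by rewrite /psi drop_polyD lamD coefD !(polyCD, polyCN, polyCM) /=; ring.
Qed.

Lemma trD e y z : pin e y -> pin e z -> tr e (y + z) = tr e y + tr e z.
Proof.
case: e => /=; first by move=> _ _; apply: psiD.
rewrite /phi => py pz; rewrite lamD divzDl // coefD !(polyCD, polyCN); ring.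
Qed.

Lemma tr0 e : tr e 0 = 0.
Proof. by apply: (addIr (tr e 0)); rewrite -trD ?pin0 // !add0r. Qed.

Lemma trN e y : pin e y -> tr e (- y) = - tr e y.
Proof.
by move=> py; apply: (addIr (tr e y)); rewrite -trD ?pinN // !addNr tr0.
Qed.

End Base.

(** * Normal forms of the HNN extension *)

Section NormalForms.
Variables (m : int) (r : nat -> int).
Hypothesis m0 : m != 0.
Local Notation pin := (pin m r).
Local Notation tr := (tr m r).
Local Notation rep := (rep m r).

(* [([:: (e1, j1); ..; (en, jn)], p)] stands for
   [b^j1 a^e1 ... b^jn a^en p] with [p] in the base group. *)
Definition nform := (seq (bool * int) * {poly int})%type.
Definition nf1 : nform := ([::], 0).

(** Left multiplication by y: with k = [rep e z], the product z a^e equals k a^e times the base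
    element [tr (~~ e) (z - k)], which is carried on to the right. *)
Fixpoint push (y : {poly int}) (s : seq (bool * int)) : nform :=
  if s is (e, j) :: s' then
    let z := y + j%:P in
    let t := push (tr (~~ e) (z - (rep e z)%:P)) s' in
    ((e, rep e z) :: t.1, t.2)
  else ([::], y).

Definition actE (y : {poly int}) (x : nform) : nform :=
  let t := push y x.1 in (t.1, t.2 + x.2).

Definition actA (e : bool) (x : nform) : nform :=
  if x.1 is (e', j) :: s' then
    if (e' == ~~ e) && (j == 0) then (s', x.2) else ((e, 0) :: x.1, x.2)
  else ([:: (e, 0)], x.2).

(** For canonical representatives, a subword a^e b^j a^-e cancels exactly when j = 0, by
    [rep_eq0]. *)
Definition no_backtrack (l l' : bool * int) : bool :=
  ~~ ((l'.1 == ~~ l.1) && (l'.2 == 0)).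
Definition canonical_rep (l : bool * int) : bool := rep l.1 (l.2)%:P == l.2.
Definition wf (x : nform) : bool :=
  all canonical_rep x.1 && sorted no_backtrack x.1.

Lemma push0 s : all canonical_rep s -> push 0 s = (s, 0).
Proof.
elim: s => [|[e j] s IH] //= /andP[/eqP/= cj cs].
by rewrite add0r cj subrr tr0 // IH.
Qed.

Lemma pushD y z s :
  push (y + z) s =
  ((push y (push z s).1).1, (push y (push z s).1).2 + (push z s).2).
Proof.
elim: s y z => [|[e j] s IH] y z //=.
have E : rep e (y + (rep e (z + j%:P))%:P) = rep e (y + z + j%:P).
  by rewrite rep_addr addrA.
have pz := pin_rep m r e (z + j%:P).
have py := pin_rep m r e (y + (rep e (z + j%:P))%:P).
rewrite E in py *; set k := rep e (y + z + _) in py *.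
set k2 := rep e (z + _) in pz py *.
have -> : y + z + j%:P - k%:P = (y + k2%:P - k%:P) + (z + j%:P - k2%:P) by ring.
by rewrite trD // IH.
Qed.

(** If the first sign is opposite to that of [l], adding [c] keeps the first representative
    ([rep_addl]), so no cancellation appears; what is carried on is again pinned by the next
    letter. *)
Lemma path_push l c s : pin l.1 c -> all canonical_rep s ->
  path no_backtrack l s -> path no_backtrack l (push c s).1.
Proof.
elim: s l c => [|[e j] s IH] l c //= pc /andP[/eqP/= cj cs] /andP[nb ps].
apply/andP; split.
  move: nb; rewrite /no_backtrack /=; case: eqP => //= ee nj.
  by rewrite rep_addl ?cj // ee negbK.
apply: IH => //=; last by move: ps; case: (s).
by rewrite -{1}[e]negbK pin_tr ?pin_rep.
Qed.

Lemma all_push c s : all canonical_rep (push c s).1.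
Proof.
by elim: s c => [|[e j] s IH] c //=; rewrite IH andbT /canonical_rep rep_rep.
Qed.

Lemma wf_actE y x : wf x -> wf (actE y x).
Proof.
case: x => s p /andP[/= cs ss]; rewrite /wf /= all_push /=.
case: s cs ss => [|[e j] s] //= /andP[/eqP/= cj cs] ps.
by apply: path_push => //=; [rewrite -{1}[e]negbK pin_tr ?pin_rep | move: ps; case: (s)].
Qed.

Lemma wf_actA e x : wf x -> wf (actA e x).
Proof.
case: x => -[|[e' j] s] p; rewrite /wf /actA /=.
  by rewrite /canonical_rep /= rep0 // eqxx.
move=> /andP[/andP[cj cs] ss]; case: ifP => [_|nb] /=.
  by rewrite cs (path_sorted ss).
by rewrite cj cs ss /canonical_rep /no_backtrack /= rep0 // eqxx nb.
Qed.

Lemma actED y z x : actE (y + z) x = actE y (actE z x).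
Proof. by case: x => s p; rewrite /actE pushD /= addrA. Qed.

Lemma actE0 x : wf x -> actE 0 x = x.
Proof. by case: x => s p /andP[cs _]; rewrite /actE /= push0 // add0r. Qed.

Lemma actAK e x : wf x -> actA (~~ e) (actA e x) = x.
Proof.
case: x => -[|[e' j] s] p; rewrite /wf /actA /=; first by rewrite negbK !eqxx.
move=> /andP[/andP[cj cs] ss]; case: ifP => /= [/andP[/eqP e1 /eqP->]|nb].
  case: s ss {cs} => [|[e'' k] s] //=; first by rewrite e1.
  by rewrite /no_backtrack /= -e1 => /andP[/negbTE->].
by rewrite negbK !eqxx.
Qed.

(** The HNN relation on normal forms. If a^e cancels, the first representative is 0 before and after
    adding y; if not, [tr e y] has representative 0 at the new letter and passes through it as y, by
    [trK]. *)
Lemma actAE e y x : wf x -> pin e y ->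
  actA e (actE y x) = actE (tr e y) (actA e x).
Proof.
case: x => -[|[e' j] s] p; rewrite /wf /actA /actE /=.
  move=> _ py; rewrite addr0; have pt := pin_tr py.
  have -> : rep e (tr e y) = 0 by apply/eqP; rewrite rep_eq0.
  by rewrite subr0 trK.
move=> /andP[/andP[/eqP/= cj cs] ss] py; have pt := pin_tr py.
have r0 : rep e (tr e y) = 0 by apply/eqP; rewrite rep_eq0.
have E : (e' == ~~ e) -> rep e' (y + j%:P) = j.
  by move/eqP=> ee; rewrite rep_addl ?cj // ee negbK.
case: eqP E => /= [->|ne] E; last by rewrite addr0 r0 subr0 trK.
rewrite E //; case: eqP => [->|nj] /=; last first.
  by rewrite addr0 r0 subr0 trK //= E.
by rewrite polyC0 subr0 addr0 negbK.
Qed.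

End NormalForms.

Definition gen_code (g : gen) : option nat := if g is GE i then Some i else None.
Definition gen_decode (o : option nat) : gen := if o is Some i then GE i else GA.
Lemma gen_codeK : cancel gen_code gen_decode. Proof. by case. Qed.
HB.instance Definition _ := Countable.copy gen (can_type gen_codeK).

(** * Integer powers and group homomorphisms *)

Section ZPower.
Variable H : groupType.
Local Open Scope group_scope.

Definition zexp (x : H) (z : int) : H :=
  match z with Posz n => x ^+ n | Negz n => x ^- n.+1 end.

Lemma zexpS x z : zexp x (1 + z)%R = x * zexp x z.
Proof.
case: z => [n|[|n]]; first by rewrite /= -expgS.
  by rewrite /= mulgV.
have -> : (1 + Negz n.+1)%R = Negz n by lia.
by rewrite /= [x ^+ n.+2]expgSr invgM mulVKg.
Qed.

Lemma zexpB1 x z : zexp x (-1 + z)%R = x^-1 * zexp x z.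
Proof. by rewrite -[X in _ * zexp x X](addKr (-1)%R) opprK zexpS mulKg. Qed.

Lemma zexpD x y z : zexp x (y + z)%R = zexp x y * zexp x z.
Proof.
elim/int_rect: y => [|n IH|n IH]; first by rewrite add0r mul1g.
  by rewrite intS -addrA !zexpS IH mulgA.
by rewrite intS opprD -addrA !zexpB1 IH mulgA.
Qed.

Lemma zexpJ x y z : zexp (x ^ y) z = zexp x z ^ y.
Proof. by case: z => n /=; rewrite -conjXg // conjVg. Qed.

Lemma commute_zexp x y z : commute x y -> commute x (zexp y z).
Proof. by case: z => n cxy /=; [|apply: commuteV]; apply: commuteX. Qed.

Lemma zexpN x z : zexp x (- z)%R = (zexp x z)^-1.
Proof. by apply: (mulIg (zexp x z)); rewrite -zexpD addNr mulVg. Qed.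

End ZPower.

Section GroupLemmas.
Variables (H : groupType) (F : H -> H).
Local Open Scope group_scope.

Lemma conj_conjV (c x : H) : c^-1 * (c * x * c^-1) * c = x.
Proof. by rewrite -!mulgA mulKg mulVg mulg1. Qed.

Lemma conjV_conj (c x : H) : c * (c^-1 * x * c) * c^-1 = x.
Proof. by rewrite -!mulgA mulVKg mulgV mulg1. Qed.

Hypothesis FM : {morph F : x y / x * y}.

Lemma hom_1 : F 1 = 1.
Proof. by apply: (mulgI (F 1)); rewrite -FM !mulg1. Qed.

Lemma hom_V x : F x^-1 = (F x)^-1.
Proof. by apply: (mulIg (F x)); rewrite -FM !mulVg hom_1. Qed.

Lemma hom_zexp x k : F (zexp x k) = zexp (F x) k.
Proof.
elim/int_rect: k => [|n IH|n IH]; first exact: hom_1.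
  by rewrite intS !zexpS FM IH.
by rewrite intS opprD !zexpB1 FM hom_V IH.
Qed.

End GroupLemmas.

(** * The group as a quotient of words *)

Section QuotientGroup.
Variables (m : int) (r : nat -> int).
Local Notation weq := (wequiv m r).

Lemma weq_catl w u v : weq u v -> weq (w ++ u) (w ++ v).
Proof.
elim=> {u v} [u|u v _|u v t _ ? _|u v l|u v R rR].
- exact: weq_refl.
- exact: weq_sym.
- exact: weq_trans.
- by rewrite !catA; apply: weq_free.
- by have := @weq_rel m r (w ++ u) v R rR; rewrite -!catA.
Qed.

Lemma weq_catr w u v : weq u v -> weq (u ++ w) (v ++ w).
Proof.
elim=> {u v} [u|u v _|u v t _ ? _|u v l|u v R rR].
- exact: weq_refl.
- exact: weq_sym.
- exact: weq_trans.
- by rewrite -!catA /=; apply: weq_free.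
- by rewrite -!catA; apply: weq_rel.
Qed.

Lemma inv_wordK : involutive inv_word.
Proof.
move=> w; rewrite /inv_word map_rev revK -map_comp map_id_in // => -[g b] _.
by rewrite /inv_letter /= negbK.
Qed.

Lemma weq_mulV w : weq (w ++ inv_word w) [::].
Proof.
elim: w => [|l w IH]; first exact: weq_refl.
rewrite /inv_word map_cons rev_cons -cats1 cat_cons catA.
apply: (@weq_trans _ _ _ ([:: l] ++ [:: inv_letter l])).
  by apply: (@weq_catl [:: l]); apply: (@weq_catr _ _ [::]).
exact: (@weq_free _ _ [::] [::]).
Qed.

Definition weqb : rel word := fun u v => `[< weq u v >].

Lemma weqb_refl : reflexive weqb. Proof. by move=> w; apply/asboolP/weq_refl. Qed.
Lemma weqb_sym : symmetric weqb.
Proof. by move=> u v; apply/asboolP/asboolP; apply: weq_sym. Qed.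
Lemma weqb_trans : transitive weqb.
Proof. by move=> v u w /asboolP uv /asboolP vw; apply/asboolP/(weq_trans uv). Qed.

Canonical weqb_equiv := EquivRel weqb weqb_refl weqb_sym weqb_trans.
Definition bst : Type := {eq_quot weqb_equiv}%qT.
HB.instance Definition _ := Choice.on bst.

Definition cls (w : word) : bst := \pi_({eq_quot weqb_equiv})%qT w.
Definition wrepr (x : bst) : word := repr (x : {eq_quot weqb_equiv})%qT.

Lemma cls_eq u v : cls u = cls v <-> weq u v.
Proof.
split=> [/eqmodP/asboolP //|uv]; exact/eqmodP/asboolP.
Qed.

Lemma wreprK x : cls (wrepr x) = x. Proof. exact: reprK. Qed.

Lemma wrepr_cls w : weq (wrepr (cls w)) w. Proof. by apply/cls_eq; rewrite wreprK. Qed.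

Definition bst_one : bst := cls [::].
Definition bst_mul (x y : bst) : bst := cls (wrepr x ++ wrepr y).
Definition bst_inv (x : bst) : bst := cls (inv_word (wrepr x)).

Lemma bst_mul_cls u v : bst_mul (cls u) (cls v) = cls (u ++ v).
Proof.
apply/cls_eq/(@weq_trans _ _ _ (u ++ wrepr (cls v))).
  exact/weq_catr/wrepr_cls.
exact/weq_catl/wrepr_cls.
Qed.

Lemma bst_mulA : associative bst_mul.
Proof.
move=> x y z; rewrite -[x]wreprK -[y]wreprK -[z]wreprK.
by rewrite !bst_mul_cls catA.
Qed.

Lemma bst_mul1 : left_id bst_one bst_mul.
Proof. by move=> x; rewrite -[x]wreprK bst_mul_cls. Qed.

Lemma bst_mulr1 : right_id bst_one bst_mul.
Proof. by move=> x; rewrite -[x]wreprK bst_mul_cls cats0. Qed.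

Lemma bst_mulV : right_inverse bst_one bst_inv bst_mul.
Proof.
by move=> x; rewrite -{1}[x]wreprK bst_mul_cls; apply/cls_eq/weq_mulV.
Qed.

Lemma bst_mulVl : left_inverse bst_one bst_inv bst_mul.
Proof.
move=> x; rewrite -{2}[x]wreprK bst_mul_cls -{2}[wrepr x]inv_wordK.
exact/cls_eq/weq_mulV.
Qed.

HB.instance Definition _ := isGroup.Build bst
  bst_mulA bst_mul1 bst_mulr1 bst_mulVl bst_mulV.

Local Open Scope group_scope.

Lemma cls_cat u v : cls (u ++ v) = cls u * cls v.
Proof. by rewrite -bst_mul_cls. Qed.

Lemma cls_nil : cls [::] = 1. Proof. by []. Qed.

Lemma cls_inv w : cls (inv_word w) = (cls w)^-1.
Proof.
apply: (mulgI (cls w)); rewrite mulgV -cls_cat -cls_nil; exact/cls_eq/weq_mulV.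
Qed.

Lemma cls_pow w z : cls (pow_word w z) = zexp (cls w) z.
Proof.
have cls_nseq n u : cls (flatten (nseq n u)) = cls u ^+ n.
  by elim: n => [|n IH] //=; rewrite cls_cat IH expgS.
by case: z => n; rewrite cls_nseq // cls_inv expVgn.
Qed.

Definition ga : bst := cls wa.
Definition ge (i : nat) : bst := cls (we i).

(* [ap e] is a for [e = false] and a^-1 for [e = true]. *)
Definition ap (e : bool) : bst := if e then ga^-1 else ga.

Lemma apN e : ap (~~ e) = (ap e)^-1.
Proof. by case: e; rewrite //= invgK. Qed.

Lemma cls_cons (l : letter) w :
  cls (l :: w) = cls [:: l] * cls w.
Proof. by rewrite -cls_cat. Qed.

Lemma cls_letter (l : letter) :
  cls [:: l] = match l.1 with GA => ap l.2
               | GE i => if l.2 then (ge i)^-1 else ge i end.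
Proof. by case: l => -[|i] [] //=; rewrite -cls_inv. Qed.

Lemma cls_relator R : relator m r R -> cls R = 1.
Proof. by move=> rR; apply/cls_eq; have := weq_rel [::] [::] rR; rewrite cats0. Qed.

Lemma ge_commute i j : commute (ge i) (ge j).
Proof.
have := cls_relator (rel_comm m r i j); rewrite !cls_cat !cls_inv.
by rewrite !mulgA => /divg1_eq/(canRL (mulgVK _)).
Qed.

Definition iota (y : {poly int}) : bst :=
  \prod_(i < size y) zexp (ge i) (y`_i)%R.

Lemma iotaE n (y : {poly int}) : (size y <= n)%N ->
  iota y = \prod_(i < n) zexp (ge i) (y`_i)%R.
Proof.
move=> le_yn; rewrite /iota.
rewrite (big_ord_widen n (fun i : nat => zexp (ge i) (y`_i)%R) le_yn) big_mkcond /=.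
apply: eq_bigr => i _; case: ltnP => // le_yi.
by rewrite nth_default.
Qed.

Lemma iotaD y z : iota (y + z)%R = iota y * iota z.
Proof.
rewrite !(@iotaE (maxn (size y) (size z))) ?leq_maxl ?leq_maxr ?size_polyD //.
rewrite -prodgM_commute; first by apply: eq_bigr => i _; rewrite coefD zexpD.
move=> i j _ _; apply/commute_zexp/commute_sym/commute_zexp/ge_commute.
Qed.

Lemma iota0 : iota 0 = 1. Proof. by rewrite /iota size_poly0 big_ord0. Qed.

Lemma iotaN y : iota (- y)%R = (iota y)^-1.
Proof. by apply: (mulIg (iota y)); rewrite -iotaD addNr iota0 mulVg. Qed.

Lemma iotaC y z : commute (iota y) (iota z).
Proof. by rewrite /commute -!iotaD addrC. Qed.

Lemma iotaZ y z : iota (z *: y)%R = zexp (iota y) z.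
Proof.
elim/int_rect: z => [|n IH|n IH]; first by rewrite scale0r iota0.
  by rewrite intS scalerDl scale1r iotaD zexpS IH.
by rewrite intS opprD scalerDl scaleN1r iotaD zexpB1 iotaN IH.
Qed.

Lemma iotaXn i : iota 'X^i%R = ge i.
Proof.
rewrite /iota size_polyXn big_ord_recr /= big1 ?mul1g ?coefXn ?eqxx //= => j _.
by rewrite coefXn eqn_leq andbC leqNgt ltn_ord.
Qed.

Lemma ap_iotaD e y z : pin m r e y -> pin m r e z ->
  ap e * iota y * ap (~~ e) = iota (tr m r e y) ->
  ap e * iota z * ap (~~ e) = iota (tr m r e z) ->
  ap e * iota (y + z)%R * ap (~~ e) = iota (tr m r e (y + z)%R).
Proof.
move=> py pz Ty Tz; rewrite (trD py pz) !iotaD -Ty -Tz apN.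
by rewrite -!mulgA mulKg.
Qed.

Lemma ap_iotaN e y : pin m r e y ->
  ap e * iota y * ap (~~ e) = iota (tr m r e y) ->
  ap e * iota (- y)%R * ap (~~ e) = iota (tr m r e (- y)%R).
Proof.
by move=> py Ty; rewrite (trN py) !iotaN -Ty !invgM apN invgK -!mulgA.
Qed.

Lemma lamXn n : lam r 'X^n = if n is 0 then 1%R else r n.
Proof. exact: lin_extXn. Qed.

Lemma hnn_base : zexp (ge 0) m = ap true * ge 1 * ap false.
Proof.
have := cls_relator (Defs.rel_base m r); rewrite !cls_cat !cls_inv cls_pow.
rewrite !mulgA => /divg1_eq E; rewrite -[ge 1]/(cls (we 1)) -E.
by rewrite /= !mulgA mulVg mul1g mulgVK.
Qed.

Lemma hnn_step i : (1 <= i)%N ->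
  ap false * (ge i * zexp (ge 0) (- r i)%R) * ap true = ge i.+1.
Proof.
move=> i0; have := cls_relator (rel_step m r i0).
by rewrite !cls_cat !cls_inv cls_pow !mulgA => /divg1_eq.
Qed.

Hypothesis m0 : m != 0%R.

(** The presentation gives the relation on a basis of E_{m,xi} only. The set [T] where it holds is a
    subgroup; it contains m e_0 and all y - [lam y] e_0, and these generate E_{m,xi}. *)
Lemma hnn_pin_false x : pin m r false x ->
  ap false * iota x * ap true = iota (phi m r x).
Proof.
pose T z := pin m r false z /\ ap false * iota z * ap (~~ false) = iota (tr m r false z).
have TD z t : T z -> T t -> T (z + t)%R.
  by case=> pz Tz [pt Tt]; split; [apply: pinD | apply: ap_iotaD].
have TN z : T z -> T (- z)%R.
  by case=> pz Tz; split; [rewrite pinN | apply: ap_iotaN].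
have T0 : T 0%R by split; rewrite ?pin0 // tr0 iota0 mulg1 apN mulgV.
have TZ k z : T z -> T (k *: z)%R.
  move=> Tz; elim/int_rect: k => [|k IH|k IH]; first by rewrite scale0r.
    by rewrite intS scalerDl scale1r; apply: TD.
  by rewrite intS opprD scalerDl scaleN1r; apply: TD => //; apply: TN.
have Tm : T m%:P%R.
  split; first by rewrite /pin lamC.
  rewrite /tr /phi lamC divzz m0 coefC /= -polyCD subrK mulr1.
  rewrite -[m%:P%R]mulr1 mul_polyC -(expr0 'X%R) iotaZ iotaXn hnn_base.
  by rewrite -['X%R]expr1 iotaXn /= !mulgA mulgV mul1g mulgK.
have TX n : T ('X^n - (lam r 'X^n)%:P)%R.
  rewrite lamXn; case: n => [|n]; first by rewrite subrr.
  split; first by rewrite /pin lamD lamN lamXn lamC subrr dvdz0.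
  rewrite /tr /phi lamD lamN lamXn lamC subrr div0z coefB coefXn coefC /= !sub0r opprK.
  rewrite [(_%:P + _)%R]addrC subrK -exprS iotaXn -hnn_step //.
  congr (_ * _ * _).
  by rewrite iotaD iotaXn -polyCN -[((- r n.+1)%:P)%R]mulr1 mul_polyC -(expr0 'X%R) iotaZ iotaXn.
have TE z : T (z - (lam r z)%:P)%R.
  elim/poly_int_ind: z => [|n y IH|n y IH].
  - by rewrite (_ : lam r 0 = 0%R) ?subr0 // /lam lin_ext0.
  - rewrite lamD polyCD opprD addrACA; exact: TD.
  - rewrite lamD lamN polyCD polyCN opprD addrACA -opprD; apply: TD => //; exact: TN.
move=> py; suff [] : T x by [].
rewrite -[x](subrK (lam r x)%:P%R); apply: TD => //.
by case/dvdzP: py => k ->; rewrite polyCM mul_polyC; apply: TZ.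
Qed.

Lemma hnn e y : pin m r e y -> ap e * iota y = iota (tr m r e y) * ap e.
Proof.
case: e => py; last by rewrite -(hnn_pin_false py) -mulgA mulVg mulg1.
rewrite -{1}(trK m0 py) -(hnn_pin_false (pin_tr py)) /=.
by rewrite -!mulgA mulKg.
Qed.

End QuotientGroup.

(** * The action of the group on normal forms *)

Section Britton.
Variables (m : int) (r : nat -> int).
Hypothesis m0 : m != 0.
Local Notation pin := (pin m r).
Local Notation tr := (tr m r).
Local Notation rep := (rep m r).
Local Notation wf := (wf m r).
Local Notation actE := (actE m r).
Local Notation G := (bst m r).
Local Notation iota := (@iota m r).
Local Notation ap := (@ap m r).
Local Notation cls := (cls m r).

Definition lact (l : letter) : nform -> nform :=
  match l.1 with
  | GA => actA l.2
  | GE i => actE (if l.2 then - 'X^i else 'X^i)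
  end.
Definition wact (w : word) (x : nform) : nform := foldr lact x w.

Lemma wf_lact l x : wf x -> wf (lact l x).
Proof. by case: l => -[|i] b /=; [apply: wf_actA | apply: wf_actE]. Qed.

Lemma wf_wact w x : wf x -> wf (wact w x).
Proof. by elim: w => //= l w IH wx; apply/wf_lact/IH. Qed.

Lemma wact_cat u v x : wact (u ++ v) x = wact u (wact v x).
Proof. exact: foldr_cat. Qed.

Lemma lactK l x : wf x -> lact l (lact (inv_letter l) x) = x.
Proof.
case: l => -[|i] b wx; rewrite /lact /=.
  by rewrite -{1}[b]negbK (actAK _ wx).
by rewrite -actED //; case: b; rewrite /= ?addNr ?subrr (actE0 wx).
Qed.

Lemma wact_pow i z x : wf x -> wact (pow_word (we i) z) x = actE (z *: 'X^i) x.
Proof.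
have E b n : wf x -> wact (flatten (nseq n [:: (GE i, b)])) x
                     = actE ((if b then - 'X^i else 'X^i) *+ n) x.
  move=> wx; elim: n => [|n IH]; first by rewrite (actE0 wx).
  by rewrite /= IH /lact /= -actED // mulrS.
move=> wx; rewrite -[z]intz scaler_int intz; case: z => n; first exact: (E false).
by rewrite [wact _ _](E true n.+1) // mulNrn.
Qed.

Lemma wact_relator R x : relator m r R -> wf x -> wact R x = x.
Proof.
case=> [i j||i i0] wx.
- rewrite /= /lact /= -!actED // (_ : _ + _ = 0) ?(actE0 wx) //; ring.
- have Pm : pin false m%:P by rewrite /pin lamC.
  rewrite !wact_cat wact_pow; last by do 2!apply: wf_lact.
  rewrite /= /lact /= expr0 alg_polyC (actAE m0 _ Pm); last first.
    by apply: wf_actA; apply: wf_actE.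
  rewrite (@actAK m r true) ?wf_actE // -actED //.
  by rewrite /tr /phi lamC divzz m0 coefC /= -polyCD subrK mulr1 expr1 subrr actE0.
- have Pi : pin false ('X^i - (r i)%:P).
    by rewrite /pin lamD lamN lamC lamXn; case: i i0 => // i _; rewrite subrr dvdz0.
  rewrite !wact_cat wact_pow; last by do 2!apply: wf_lact.
  rewrite /= /lact /= expr0 alg_polyC -actED // polyCN (actAE m0 _ Pi); last first.
    by apply: wf_actA; apply: wf_actE.
  rewrite (@actAK m r true) ?wf_actE // -actED //.
  rewrite /tr /phi lamD lamN lamC lamXn; case: i i0 {Pi} => // i _.
  rewrite subrr div0z coefB coefXn coefC /= !sub0r opprK.
  by rewrite [(_%:P + _)]addrC subrK -exprS subrr actE0.
Qed.

Lemma wact_wequiv u v x : wequiv m r u v -> wf x -> wact u x = wact v x.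
Proof.
move=> uv wx; elim: uv x wx => {u v} [//|u v _ IH|u v t _ IH1 _ IH2|u v l|u v R rR] x wx.
- by rewrite IH.
- by rewrite IH1 ?IH2.
- by rewrite !wact_cat /= lactK // wf_wact.
- by rewrite !wact_cat (wact_relator rR) ?wf_wact.
Qed.

Lemma wf1 : wf nf1. Proof. by []. Qed.

(** Equivalent words act alike on well-formed forms ([wact_wequiv]), so the chosen representative is
    immaterial. *)
Definition nf (x : G) : nform := wact (wrepr x) nf1.

Lemma nf_wf x : wf (nf x). Proof. exact/wf_wact/wf1. Qed.

Lemma nf_cls w : nf (cls w) = wact w nf1.
Proof. exact: wact_wequiv (wrepr_cls _ _ _) wf1. Qed.

Local Open Scope group_scope.

Lemma nf_clsM w x : nf (cls w * x) = wact w (nf x).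
Proof. by rewrite -[x]wreprK -cls_cat !nf_cls wact_cat. Qed.

Lemma nf_ap e x : nf (ap e * x) = actA e (nf x).
Proof. by rewrite -[ap e](cls_letter m r (GA, e)) nf_clsM. Qed.

Lemma nf_1 : nf 1 = nf1. Proof. by rewrite -[1]cls_nil nf_cls. Qed.

Lemma nf_iota y x : nf (iota y * x) = actE y (nf x).
Proof.
elim/poly_int_ind: y x => [|n y IH|n y IH] x.
- by rewrite iota0 mul1g actE0 ?nf_wf.
- rewrite iotaD -mulgA IH iotaXn.
  by rewrite -[ge _ _ _](cls_letter m r (GE n, false)) nf_clsM actED.
- rewrite iotaD iotaN -mulgA IH iotaXn.
  by rewrite -[_^-1](cls_letter m r (GE n, true)) nf_clsM actED.
Qed.

Fixpoint of_seq (s : seq (bool * int)) : G :=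
  if s is (e, j) :: s' then iota j%:P * ap e * of_seq s' else 1.
Definition of_nf (x : nform) : G := of_seq x.1 * iota x.2.

Lemma of_nf_actE y x : of_nf (actE y x) = iota y * of_nf x.
Proof.
case: x => s p; rewrite /of_nf /= iotaD !mulgA; congr (_ * _).
elim: s y => [|[e j] s IH] y /=; first by rewrite mul1g mulg1.
set k := rep e _; set c := y + _ - _.
have pc : pin (~~ e) c by apply: pin_rep.
rewrite -[X in _ = _ * X]mulgA !mulgA -iotaD.
have -> : (y + j%:P)%R = (k%:P + c)%R by rewrite /c; ring.
have := hnn m0 (pin_tr pc); rewrite trK // negbK => E.
by rewrite iotaD -!mulgA IH !mulgA -[_ * ap e * _]mulgA E !mulgA.
Qed.

Lemma of_nf_actA e x : of_nf (actA e x) = ap e * of_nf x.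
Proof.
case: x => -[|[e' j] s] p; rewrite /actA /of_nf /=.
  by rewrite polyC0 iota0 !mul1g mulg1.
case: ifP => [/andP[/eqP-> /eqP->]|_] /=; rewrite polyC0 iota0 !mul1g ?mulgA //.
by rewrite apN mulgV mul1g.
Qed.

Lemma nfK x : of_nf (nf x) = x.
Proof.
rewrite -[in RHS](wreprK x) /nf; elim: (wrepr x) => [|l w IH] /=.
  by rewrite /of_nf /= iota0 mulg1.
rewrite cls_cons -IH cls_letter /lact; case: l => -[|i] b /=.
  by rewrite of_nf_actA.
by rewrite of_nf_actE; case: b; rewrite ?iotaN iotaXn.
Qed.

End Britton.

(** * Reduced forms and Britton's lemma *)

Section Signature.
Variables (m : int) (r : nat -> int).
Hypothesis m0 : m != 0.
Local Notation pin := (pin m r).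
Local Notation tr := (tr m r).
Local Notation rep := (rep m r).
Local Notation wf := (wf m r).
Local Notation actE := (actE m r).
Local Notation G := (bst m r).
Local Notation iota := (@iota m r).
Local Notation ap := (@ap m r).
Local Notation of_seq := (@of_seq m r).
Local Notation of_nf := (@of_nf m r).
Local Notation push := (push m r).
Local Open Scope group_scope.

(* The signs of the a-letters in a reduced form of x (an invariant of x by Britton's
   lemma); its size is the distance between the base vertex v and x v. *)
Definition sg (x : G) : seq bool := [seq l.1 | l <- (nf x).1].

Lemma map_push y s : [seq l.1 | l <- (push y s).1] = [seq l.1 | l <- s].
Proof. by elim: s y => [|[e j] s IH] y //=; rewrite IH. Qed.

(** Uniqueness of normal forms: rebuilding a well-formed sequence letter by letter never cancels.
    With [nfK] this is a bijection between group elements and well-formed forms. *)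
Lemma nf_of_nf x : wf x -> nf (of_nf x) = x.
Proof.
case: x => s p; rewrite /of_nf /=; elim: s => [|[e j] s IH] wx /=.
  by rewrite mul1g -[iota p]mulg1 nf_iota // nf_1 // /actE /= addr0.
have /andP[/andP[/eqP/= cj cs] ss] := wx.
have ws : wf (s, p) by apply/andP; split => //=; apply: path_sorted ss.
rewrite -!mulgA nf_iota // nf_ap // IH //.
have -> : actA e (s, p) = ((e, 0%R) :: s, p).
  rewrite /actA /=; case: s ss {IH wx cs ws} => [|[e' j'] s] //=.
  by rewrite /no_backtrack /= => /andP[/negbTE->].
by rewrite /actE /= addr0 cj subrr tr0 push0 //= add0r.
Qed.

Lemma sg_1 : sg 1 = [::]. Proof. by rewrite /sg nf_1. Qed.

Lemma sg_iotal y x : sg (iota y * x) = sg x.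
Proof. by rewrite /sg nf_iota //= map_push. Qed.

Lemma sg_iotar x y : sg (x * iota y) = sg x.
Proof.
have := nf_wf x; rewrite /sg -{2}(nfK m0 x); case: (nf x) => s p ws.
rewrite /of_nf /= -mulgA -iotaD -[_ * _]/(of_nf (s, (p + y)%R)).
by rewrite nf_of_nf.
Qed.

Lemma sg_iota y : sg (iota y) = [::].
Proof. by rewrite -[iota y]mulg1 sg_iotal sg_1. Qed.

Lemma sg_nil x : sg x = [::] -> exists y, x = iota y.
Proof.
rewrite /sg -{2}(nfK m0 x); case: (nf x) => -[|//] p _.
by exists p; rewrite /of_nf /= mul1g.
Qed.

Lemma of_nf_cat s1 s2 p : of_nf (s1 ++ s2, p) = of_seq s1 * of_nf (s2, p).
Proof.
elim: s1 => [|[e j] s1 IH] /=; first by rewrite mul1g.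
by rewrite -[RHS]mulgA -IH /of_nf /= !mulgA.
Qed.

Lemma sg_of_nf x : wf x -> sg (of_nf x) = [seq l.1 | l <- x.1].
Proof. by move=> wx; rewrite /sg nf_of_nf. Qed.

Lemma sg_split x s1 s2 : sg x = s1 ++ s2 ->
  exists x1 x2, [/\ x = x1 * x2, sg x1 = s1 & sg x2 = s2].
Proof.
have := nf_wf x; rewrite /sg -{3}(nfK m0 x); case: (nf x) => s p /= ws E.
have sz : (size s1 <= size s)%N by rewrite -(size_map fst s) E size_cat leq_addr.
have := size_takel sz; move: ws E; rewrite -{1 2 4}(cat_take_drop (size s1) s).
move: (take _ _) (drop _ _) => t1 t2.
rewrite /wf /= all_cat map_cat => /andP[/andP[c1 c2] /cat_sorted2[ss1 ss2]] E sz1.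
have /andP[/eqP E1 /eqP E2] : ([seq l.1 | l <- t1] == s1) && ([seq l.1 | l <- t2] == s2).
  by rewrite -eqseq_cat ?size_map // E.
exists (of_nf (t1, 0%R)), (of_nf (t2, p)); split.
- by rewrite of_nf_cat {2}/of_nf /= iota0 mulg1.
- by rewrite -/(sg _) sg_of_nf // /wf /= c1.
- by rewrite -/(sg _) sg_of_nf // /wf /= c2.
Qed.

Lemma sg_cons x e s : sg x = e :: s ->
  exists y x', x = iota y * (ap e * x') /\ sg x' = s.
Proof.
have := nf_wf x; rewrite /sg -{3}(nfK m0 x).
case: (nf x) => -[//|[e' j] t] p /= wt [<- <-].
exists j%:P%R, (of_nf (t, p)); split; first by rewrite /of_nf /= !mulgA.
rewrite -/(sg _) sg_of_nf //; move: wt; rewrite /wf /= => /andP[/andP[_ ->]].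
exact: path_sorted.
Qed.

Lemma sg_rcons x e s : sg x = rcons s e ->
  exists x' y, x = x' * ap e * iota y /\ sg x' = s.
Proof.
rewrite -cats1 => /sg_split[x1 [x2 [-> s1 s2]]].
have [y [x3 [-> /sg_nil[z ->]]]] := sg_cons s2.
by exists (x1 * iota y), z; rewrite sg_iotar !mulgA.
Qed.

(** The vertices v and a^-e v are adjacent, so their geodesics to x v differ by one edge. *)
Lemma sg_ap e x : sg (ap e * x) = e :: sg x \/ sg x = ~~ e :: sg (ap e * x).
Proof.
rewrite /sg nf_ap //; case: (nf x) => -[|[e' j] t] p; first by left.
by rewrite /actA /=; case: ifP => [/andP[/eqP-> _]|_]; [right|left].
Qed.

Lemma sg_ap1 e : sg (ap e) = [:: e].
Proof. by rewrite -[ap e]mulg1; case: (sg_ap e 1); rewrite sg_1. Qed.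

Lemma leq_size_sg_ap e x : (size (sg (ap e * x)%g) <= (size (sg x)).+1)%N.
Proof. by case: (sg_ap e x) => [->|->] //=; apply: leqW. Qed.

Lemma leq_size_sgM x y : (size (sg (x * y)%g) <= size (sg x) + size (sg y))%N.
Proof.
move Ex: (sg x) => s; elim: s x Ex => [|e s IH] x.
  by case/sg_nil => z ->; rewrite sg_iotal.
case/sg_cons => z [x' [-> /IH le_x]].
by rewrite -!mulgA sg_iotal (leq_trans (leq_size_sg_ap _ _)).
Qed.

(** Britton's criterion: neighbouring a-letters cancel only if they are opposite and the element
    between them lies in the associated subgroup. *)
Lemma sg_ap_iota_ap e e' z y : sg (ap e' * y) = e' :: sg y ->
  e' = e \/ ~~ pin e z ->
  sg (ap e * (iota z * (ap e' * y))) = e :: e' :: sg y.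
Proof.
move=> sy ez; have := sy; rewrite /sg !(nf_ap, nf_iota) //.
case E : (nf y) => [s p]; set x := actA e' _ => /= Ex.
have -> : x = ((e', 0%R) :: s, p).
  move: Ex; rewrite /x /actA; case: s {E x} => [|[e'' j] s] //=.
  case: ifP => //= _ /(congr1 size); rewrite /= size_map => /eqP.
  by rewrite eqn_leq ltnNge leqnSn andbF.
rewrite /actE /actA /= addr0 rep_eq0; case: ifP => /=; last by rewrite map_push.
case/andP => /eqP ee; rewrite ee negbK => pz.
by case: ez => [|/negP//]; rewrite ee; case: (e).
Qed.

(** Appending a^e to the normal form of x leaves a remainder [c] in the associated subgroup;
    carrying it through the normal form of y creates no cancellation, by [path_push]. *)
Lemma sg_mul_ap x e y : sg (x * ap e) = rcons (sg x) e ->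
  sg (ap e * y) = e :: sg y -> sg (x * (ap e * y)) = sg x ++ e :: sg y.
Proof.
case Ex : (nf x) (nf_wf x) (nfK m0 x) => [s q] ws.
rewrite /of_nf /= => xE sxe sey.
have sx : sg x = [seq l.1 | l <- s] by rewrite /sg Ex.
pose k := rep e q; pose c := tr (~~ e) (q - k%:P)%R.
have pq : pin (~~ e) (q - k%:P)%R by apply: pin_rep.
have pc : pin e c by rewrite -[e]negbK pin_tr.
have xe : x * ap e = of_seq (rcons s (e, k)) * iota c.
  rewrite -cats1 -[RHS]/(of_nf (_, _)) of_nf_cat /of_nf /= mulg1 -xE.
  rewrite -!mulgA; congr (_ * _).
  have := hnn m0 pc; rewrite {2}/c -{2}[e]negbK trK // => ->.
  by rewrite mulgA -iotaD addrC subrK.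
have ck : canonical_rep m r (e, k) by rewrite /canonical_rep /= rep_rep.
have /andP[cs ss] := ws.
have pth : sorted no_backtrack (rcons s (e, k)).
  case/lastP: s {Ex ws} cs xE sx xe ss => [//|s1 [e1 j1]] cs xE sx xe ss.
  (* If a^e cancelled the last letter of x, then x a^e would have the signature of [s1], against
     [sxe]. *)
  have nb : no_backtrack (e1, j1) (e, k).
    apply/negP => /andP[/eqP/= ee /eqP k0].
    have pq' : pin e1 q by rewrite -[e1]negbK -ee -rep_eq0 -/k k0.
    have xE1 : x * ap e = of_nf (s1, 0%R) * iota (j1%:P + tr e1 q)%R.
      rewrite -xE -cats1 -[_ * iota q]/(of_nf (_, _)) of_nf_cat {1}/of_nf /= ee.
      rewrite /of_nf /= iota0 !mulg1 iotaD -!mulgA; do 2!congr (_ * _).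
      by rewrite mulgA (hnn m0 pq') apN mulgK.
    move: sxe; rewrite xE1 sg_iotar sx sg_of_nf; last first.
      move: cs ss; rewrite /wf -cats1 all_cat => /andP[-> _].
      by case/cat_sorted2.
    by move/(congr1 size); rewrite !(size_rcons, size_map) /=; lia.
  case: s1 ss {cs xE sx xe} => [|l0 s0] /=; first by rewrite nb.
  by rewrite !rcons_path last_rcons nb => ->.
have -> : x * (ap e * y) = of_seq (rcons s (e, k)) * (iota c * y).
  by rewrite mulgA xe mulgA.
have yh : path no_backtrack (e, k) (nf y).1.
  have := nf_wf y; move: sey; rewrite /sg nf_ap //.
  case: (nf y) => -[//|[e' j'] t] p; rewrite /actA; case: ifP => /= nb.
    move=> /(congr1 size)/eqP.
    by rewrite /= -addn2 -[X in X == _]addn0 eqn_add2l.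
  by move=> _ /andP[_ /= ->]; rewrite /no_backtrack /= nb.
have := wf_actE c (nf_wf y); rewrite -{1}(nfK m0 (iota c * y)) nf_iota //.
rewrite /actE /=; have cy : all (canonical_rep m r) (nf y).1 by case/andP: (nf_wf y).
have := @path_push m r (e, k) c _ pc cy yh; set t := (push c (nf y).1).
move=> pt /andP[ct _]; rewrite -of_nf_cat sg_of_nf; last first.
  rewrite /wf /= all_cat all_rcons ck cs [all _ t.1]ct /=.
  case: s {Ex ws cs xE sx xe} pth ss pt => [|l s] //=.
  by rewrite cat_path last_rcons => -> _ ->.
by rewrite map_cat map_rcons map_push cat_rcons -sx.
Qed.

Lemma sg_junction x e e' z y : sg (x * ap e) = rcons (sg x) e ->
  sg (ap e' * y) = e' :: sg y -> e' = e \/ ~~ pin e z ->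
  sg (x * (ap e * (iota z * (ap e' * y)))) = sg x ++ e :: e' :: sg y.
Proof.
move=> sx sy ez; rewrite sg_mul_ap // !sg_iotal ?sy //; exact: sg_ap_iota_ap.
Qed.

Lemma sg_inv x : sg x^-1 = rev (map negb (sg x)).
Proof.
have [n] := ubnP (size (sg x)); elim: n x => // n IH x.
case/lastP E : (sg x) => [|s e]; first by case: (sg_nil E) => y ->; rewrite -iotaN sg_iota.
rewrite size_rcons ltnS => lt_n; have [x1 [z [xE s1]]] := sg_rcons E.
have IH1 : sg x1^-1 = rev (map negb s) by rewrite IH s1.
rewrite xE invgM -iotaN sg_iotal invgM -apN map_rcons rev_rcons.
have [->|] := sg_ap (~~ e) x1^-1; first by rewrite IH1.
(* If the letter cancels, [w] has length |s| - 1, and by induction so has its inverse; but that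
   inverse is x up to a base element, of length |s| + 1. *)
set w := ap _ * _; rewrite IH1 => sw.
have szw : (size (sg w)).+1 = size s by move/(congr1 size): sw; rewrite size_rev size_map.
rewrite -szw in lt_n; have /(congr1 size) := IH w (ltnW lt_n).
have -> : w^-1 = x * iota (- z)%R by rewrite xE /w invgM invgK -apN negbK iotaN mulgK.
by rewrite sg_iotar E size_rev size_map size_rcons; lia.
Qed.

Definition ht (e : bool) : int := (if e then -1 else 1)%R.
Definition aexp (x : G) : int := (\sum_(e <- sg x) ht e)%R.

Lemma aexp_ap e x : aexp (ap e * x) = (ht e + aexp x)%R.
Proof.
rewrite /aexp; case: (sg_ap e x) => ->; rewrite big_cons //.
by rewrite addrA; case: e; rewrite /ht /= ?addNr ?subrr add0r.
Qed.

Lemma aexp_iotal y x : aexp (iota y * x) = aexp x.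
Proof. by rewrite /aexp sg_iotal. Qed.

Lemma bst_ind (Q : G -> Prop) : Q 1 ->
  (forall y x, Q x -> Q (iota y * x)) -> (forall e x, Q x -> Q (ap e * x)) ->
  forall x, Q x.
Proof.
move=> Q1 QE QA x; rewrite -(nfK m0 x); case: (nf x) => s p; rewrite /of_nf /=.
elim: s => [|[e j] s IH] /=; last by rewrite -!mulgA; apply/QE/QA.
by rewrite mul1g -[iota p]mulg1; apply: QE.
Qed.

Lemma aexpM x y : aexp (x * y) = (aexp x + aexp y)%R.
Proof.
elim/bst_ind: x => [|z x IH|e x IH]; last by rewrite -mulgA !aexp_ap IH addrA.
  by rewrite mul1g {2}/aexp sg_1 big_nil add0r.
by rewrite -mulgA !aexp_iotal.
Qed.

Lemma aexp_iota y : aexp (iota y) = 0%R.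
Proof. by rewrite /aexp sg_iota big_nil. Qed.

Lemma aexp_1 : aexp 1 = 0%R. Proof. by rewrite /aexp sg_1 big_nil. Qed.

Lemma aexpV x : aexp x^-1 = (- aexp x)%R.
Proof. by apply: (addIr (aexp x)); rewrite -aexpM mulVg aexp_1 addNr. Qed.

Lemma aexp_ap1 e : aexp (ap e) = ht e.
Proof. by rewrite -[ap e]mulg1 aexp_ap aexp_1 addr0. Qed.

End Signature.

(** * The map to the wreath product *)

Section Metabelian.
Variables (m : int) (r : nat -> int).
Hypothesis m0 : m != 0.
Local Notation pin := (pin m r).
Local Notation tr := (tr m r).
Local Notation rep := (rep m r).
Local Notation actE := (actE m r).
Local Notation G := (bst m r).
Local Notation iota := (@iota m r).

(* Image of e_i in Z[t], where Z wr Z is the semidirect product of Z[t, 1/t] by <t>. *)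
Fixpoint qgen (i : nat) : {poly int} :=
  match i with
  | 0 => 1
  | j.+1 => if j is 0 then m *: 'X else 'X * (qgen j - (r j)%:P)
  end.
Definition qpol (y : {poly int}) : {poly int} := lin_ext qgen y.

Lemma qpolD y z : qpol (y + z) = qpol y + qpol z. Proof. exact: lin_extD. Qed.
Lemma qpolN y : qpol (- y) = - qpol y. Proof. exact: lin_extN. Qed.
Lemma qpolC k : qpol k%:P = k%:P.
Proof. by rewrite /qpol lin_extC /= -[in RHS](intz k) rmorph_int. Qed.
Lemma qpol1 : qpol 1 = 1. Proof. by rewrite -polyC1 qpolC. Qed.
Lemma qpolXn i : qpol 'X^i = qgen i. Proof. exact: lin_extXn. Qed.

Lemma coef0_qpol (y : {poly int}) : (qpol y)`_0 = y`_0.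
Proof.
elim/poly_int_ind: y => [|n y IH|n y IH]; first by rewrite /qpol lin_ext0.
  rewrite qpolD qpolXn !coefD IH coefXn; congr (_ + _).
  by case: n => [|[|n]] /=; rewrite ?coefC ?coefZ ?coefX ?mulr0 // coefXM.
rewrite qpolD qpolN qpolXn !(coefD, coefN) IH coefXn; congr (_ - _).
by case: n => [|[|n]] /=; rewrite ?coefC ?coefZ ?coefX ?mulr0 // coefXM.
Qed.

Lemma qpol_psi (y : {poly int}) : y`_0 = 0 -> 'X * qpol (psi m r y) = qpol y.
Proof.
have EX n : 'X * qpol (psi m r 'X^n) = qpol 'X^n - (('X^n : {poly int})`_0)%:P.
  rewrite /psi qpolXn coefXn; case: n => [|n].
    by rewrite drop_poly_eq0 ?size_poly1 // coef0 /lam lin_ext0 mulr0 subr0 addr0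
      /qpol lin_ext0 mulr0 subrr.
  rewrite exprS drop1_XM coefXn lamXn subr0 qpolD qpolXn qpolC.
  case: n => [|n] /=; last by rewrite mulr0 sub0r polyCN.
  by rewrite mulr1 addrC polyCB subrK mulrC mul_polyC.
have E z : 'X * qpol (psi m r z) = qpol z - (z`_0)%:P.
  elim/poly_int_ind: z => [|n z IH|n z IH].
  - by rewrite (tr0 m r true : psi m r 0 = 0) /qpol lin_ext0 coef0 mulr0 subrr.
  - rewrite psiD qpolD mulrDr IH EX qpolD coefD polyCD; ring.
  - have H : 'X * qpol (psi m r (z - 'X^n)) + 'X * qpol (psi m r 'X^n) = 'X * qpol (psi m r z).
      by rewrite -mulrDr -qpolD -psiD subrK.
    apply: (addIr ('X * qpol (psi m r 'X^n))).
    rewrite H IH EX qpolD qpolN coefB polyCB; ring.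
by move=> y0; rewrite E y0 subr0.
Qed.

Lemma qpol_tr e y : pin e y ->
  qpol (tr e y) = if e then drop_poly 1 (qpol y) else 'X * qpol y.
Proof.
case: e => [/eqP y0|py]; rewrite /tr.
  by rewrite -(qpol_psi y0) drop1_XM.
rewrite -qpol_psi /phi ?coefXM //; congr (_ * qpol _).
exact: (@trK m r m0 false).
Qed.

(** Descent on the degree: y_0 = 0 by [coef0_qpol], so y lies in E_1, and [psi y] has smaller size
    and image [qpol y] divided by t, again 0. *)
Lemma qpol_eq0 y : qpol y = 0 -> y = 0.
Proof.
have [n] := ubnP (size y); elim: n y => // n IH y lt_n q0.
have y0 : y`_0 = 0 by rewrite -coef0_qpol q0 coef0.
have pp : psi m r y = 0.
  have q1 : qpol (psi m r y) = 0.
    by apply/eqP; rewrite -(mulrI_eq0 _ (monic_lreg (monicX int))) qpol_psi ?q0.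
  have [/size1_polyC yC|lt1] := leqP (size y) 1.
    by rewrite yC y0 polyC0; apply: (tr0 m r true).
  apply: IH q1; rewrite ltnS in lt_n; apply: leq_trans lt_n.
  rewrite /psi (leq_ltn_trans (size_polyD _ _)) // gtn_max size_drop_poly.
  by rewrite (leq_ltn_trans (size_polyC_leq1 _)) // andbT; lia.
rewrite -(@trK m r m0 true y) ?/pin ?y0 //= /tr /= pp; exact: (tr0 m r false).
Qed.

Local Notation K := {fraction {poly int}}.
Local Notation "p %:K" := (@FracField.tofrac {poly int} p) (at level 2).
(** The fraction field of Z[t] stands in for Z[t, 1/t], so that t has integer powers. *)
Definition tK : K := 'X%:K.

Lemma tK_neq0 : tK != 0. Proof. by rewrite tofrac_eq0 polyX_eq0. Qed.
Lemma tK_unit : tK \is a GRing.unit. Proof. by rewrite unitfE tK_neq0. Qed.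

Lemma qpol_trK e y : pin e y -> (qpol (tr e y))%:K = tK ^ ht e * (qpol y)%:K.
Proof.
move=> py; have := qpol_tr py; case: e py => py ->; last by rewrite expr1z tofracM.
have y0 : y`_0 = 0 by apply/eqP.
by rewrite -[in RHS](qpol_psi y0) tofracM mulKr ?tK_unit // -(qpol_psi y0) drop1_XM.
Qed.

Fixpoint Pseq (s : seq (bool * int)) (v : K) : K :=
  if s is (e, j) :: s' then j%:P%:K + tK ^ ht e * Pseq s' v else v.
Definition Pnf (x : nform) : K := Pseq x.1 (qpol x.2)%:K.
(* The Z[t, 1/t]-coordinate of the image of x in Z wr Z; the other one is [aexp x]. *)
Definition Pcoord (x : G) : K := Pnf (nf x).

Lemma Pnf_actE y x : Pnf (actE y x) = (qpol y)%:K + Pnf x.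
Proof.
case: x => s p; rewrite /Pnf /actE /=.
elim: s y => [|[e j] s IH] y /=; first by rewrite qpolD tofracD.
set k := rep e _; have pz := pin_rep m r e (y + j%:P); rewrite -/k in pz.
rewrite IH qpol_trK // mulrDr mulrA -expfzDr ?tK_neq0 //.
have -> : ht e + ht (~~ e) = 0 by case: (e).
rewrite expr0z mul1r qpolD qpolN qpolD !qpolC !tofracD tofracN; ring.
Qed.

Lemma Pnf_actA e x : Pnf (actA e x) = tK ^ ht e * Pnf x.
Proof.
case: x => -[|[e' j] s] p; rewrite /Pnf /actA /= ?tofrac0 ?add0r //.
case: ifP => [/andP[/eqP-> /eqP->]|_] /=; last by rewrite polyC0 tofrac0 add0r.
rewrite polyC0 tofrac0 add0r mulrA -expfzDr ?tK_neq0 //.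
have -> : ht e + ht (~~ e) = 0 by case: (e).
by rewrite expr0z mul1r.
Qed.

(** This cocycle identity is the multiplication rule of Z wr Z. *)
Lemma PcoordM x y : Pcoord (x * y)%g = Pcoord x + tK ^ aexp x * Pcoord y.
Proof.
elim/(@bst_ind m r m0): x => [|z x IH|e x IH].
- by rewrite mul1g aexp_1 // expr0z mul1r /Pcoord nf_1 // /Pnf /= /qpol lin_ext0 tofrac0 add0r.
- by rewrite -mulgA /Pcoord !nf_iota // !Pnf_actE [Pnf (nf (x * y)%g)]IH aexp_iotal // addrA.
- rewrite -mulgA /Pcoord !nf_ap // !Pnf_actA [Pnf (nf (x * y)%g)]IH aexp_ap //.
  by rewrite expfzDr ?tK_neq0 // mulrDr mulrA.
Qed.

Lemma Pcoord_iota y : Pcoord (iota y) = (qpol y)%:K.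
Proof.
by rewrite -[iota y]mulg1 /Pcoord nf_iota // nf_1 // Pnf_actE /Pnf /= /qpol lin_ext0 tofrac0 addr0.
Qed.

Lemma Pcoord_1 : Pcoord 1%g = 0.
Proof. by rewrite -iota0 Pcoord_iota /qpol lin_ext0 tofrac0. Qed.

Lemma PcoordV x : Pcoord x^-1%g = - (tK ^ (- aexp x) * Pcoord x).
Proof.
have := PcoordM x^-1%g x; rewrite mulVg Pcoord_1 aexpV // => /esym/eqP.
by rewrite addr_eq0 => /eqP.
Qed.

Lemma PcoordJ x y : aexp y = 0 ->
  Pcoord (x * y * x^-1)%g = tK ^ aexp x * Pcoord y.
Proof.
move=> y0; rewrite !PcoordM PcoordV aexpM // y0 addr0 mulrN mulrA.
rewrite -expfzDr ?tK_neq0 // subrr expr0z mul1r.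
by rewrite addrAC subrr add0r.
Qed.

End Metabelian.

(** * Geometry of the tree *)

Definition hgt (s : seq bool) : int := \sum_(e <- s) ht e.

(* All partial heights of [s] are at most [h]. *)
Fixpoint low (h : int) (s : seq bool) : bool :=
  (0 <= h) && (if s is e :: s' then low (h - ht e) s' else true).

Lemma hgt_cons e s : hgt (e :: s) = ht e + hgt s. Proof. exact: big_cons. Qed.
Lemma hgt_nil : hgt [::] = 0. Proof. exact: big_nil. Qed.
Lemma hgt_cat s1 s2 : hgt (s1 ++ s2) = hgt s1 + hgt s2. Proof. exact: big_cat. Qed.

Lemma low_ge0 h s : low h s -> 0 <= h. Proof. by case: s => [|e s] /andP[]. Qed.

Lemma low_mono h h' s : h <= h' -> low h s -> low h' s.
Proof.
elim: s h h' => [|e s IH] h h' le_h /= /andP[h0 ls].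
  by rewrite (le_trans h0).
by rewrite (le_trans h0) //= (IH (h - ht e)) // lerD2r.
Qed.

Lemma low_cat h s1 s2 : low h (s1 ++ s2) = low h s1 && low (h - hgt s1) s2.
Proof.
elim: s1 h => [|e s1 IH] h /=.
  rewrite hgt_nil subr0 andbT; case: (boolP (low h s2)) => [/low_ge0->//|_].
  by rewrite andbF.
by rewrite IH hgt_cons opprD addrA andbA.
Qed.

Lemma low_hgt h s : low h s -> hgt s <= h.
Proof.
elim: s h => [|e s IH] h /= /andP[h0 ls]; first by rewrite hgt_nil.
by rewrite hgt_cons addrC -lerBrDr; apply: IH.
Qed.

Lemma low_size s : low (size s)%:Z s.
Proof.
elim: s => [|e s IH] //=; apply: low_mono IH.
by case: e; rewrite /ht; lia.
Qed.

Lemma hgt_size s : hgt s <= (size s)%:Z.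
Proof. exact/low_hgt/low_size. Qed.

Lemma low_first_exit h s : 0 <= h -> ~~ low h s ->
  exists s1 s2, [/\ s = s1 ++ false :: s2, low h s1 & hgt s1 = h].
Proof.
elim: s h => [|e s IH] h h0 /=; rewrite h0 //= => nl.
have [he|he] := leP 0 (h - ht e).
  have [s1 [s2 [-> l1 h1]]] := IH _ he nl.
  exists (e :: s1), s2; split; rewrite //= ?h0 //.
  by rewrite hgt_cons h1 addrC subrK.
case: e he {nl} => /= he; first by rewrite /ht in he; lia.
exists [::], s; split; rewrite //= ?h0 // hgt_nil; rewrite /ht in he; lia.
Qed.

Lemma low0_first s e : low 0 (e :: s) -> e = true.
Proof. by case: e => //= /low_ge0; rewrite /ht; lia. Qed.

Lemma low0_last s e : low 0 (rcons s e) -> hgt (rcons s e) = 0 -> e = false.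
Proof.
rewrite -cats1 low_cat hgt_cat hgt_cons hgt_nil => /andP[/low_hgt le0 _].
by case: e => //; rewrite /ht; lia.
Qed.

(** First-return decomposition: the path steps down, and the displayed [false] is its first return
    to height 0. *)
Lemma low0_decomp s : low 0 s -> hgt s = 0 -> s != [::] ->
  exists s1 s2, [/\ s = true :: s1 ++ false :: s2,
    low 0 s1 /\ hgt s1 = 0 & low 0 s2 /\ hgt s2 = 0].
Proof.
case: s => // e s ls hs _; have ee := low0_first ls; subst e.
move: ls hs; rewrite hgt_cons /= => ls hs.
have nl : ~~ low 0 s by apply/negP => /low_hgt; lia.
have [s1 [s2 [E l1 h1]]] := low_first_exit (lexx 0) nl.
exists s1, s2; split; rewrite ?E //.
move: ls hs; rewrite E low_cat hgt_cat hgt_cons h1 /=.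
move=> /andP[_ l2] hs; split; last by lia.
by move: l2; rewrite (_ : 0 - (-1) - 0 - 1 = 0) //; lia.
Qed.

Section Geometry.
Variables (m : int) (r : nat -> int).
Hypothesis m0 : m != 0.
Local Notation pin := (pin m r).
Local Notation G := (bst m r).
Local Notation iota := (@iota m r).
Local Notation ap := (@ap m r).
Local Open Scope group_scope.

(* No cancellation occurs in the product x y. *)
Definition sgM (x y : G) : Prop := sg (x * y) = sg x ++ sg y.

Lemma sg_ap_tail e w s : sg (ap e * w) = e :: s -> (size (sg w) <= size s)%N ->
  sg w = s.
Proof.
move=> sew lws; case: (sg_ap m0 e w); first by rewrite sew => -[].
by rewrite sew => E; move: lws; rewrite E /= ltnNge leqnSn.
Qed.

Lemma sgM_consl e x y : sgM (ap e * x) y -> sg (ap e * x) = e :: sg x -> sgM x y.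
Proof.
rewrite /sgM -mulgA => E sx; apply: (@sg_ap_tail e); first by rewrite E sx.
by rewrite size_cat leq_size_sgM.
Qed.

Lemma sgM_ap e x y : sg (ap e * x) = e :: sg x -> sgM x y -> sg x != [::] ->
  sg (ap e * (x * y)) = e :: sg x ++ sg y.
Proof.
case E : (sg x) => [//|e' s] sex xy _.
have [z [x' [xE sx']]] := sg_cons m0 E.
have sx : sg (ap e' * x') = e' :: sg x' by rewrite sx' -E xE sg_iotal.
have xy1 : sgM (ap e' * x') y.
  by move: xy; rewrite /sgM xE -!mulgA !sg_iotal.
have xy' : sgM x' y by apply: sgM_consl xy1 sx.
have ez : e' = e \/ ~~ pin e z.
  case: (boolP (pin e z)) => pz; last by right.
  left; apply/eqP; apply: contraT => ne.
  have e'E : e' = ~~ e by case: (e) (e') ne => -[].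
  move: sex; rewrite xE mulgA hnn // -mulgA e'E apN mulVKg sg_iotal // sx'.
  by move/(congr1 size) => /=; lia.
rewrite xE -!mulgA sg_ap_iota_ap // ?xy' ?sx' //.
by rewrite mulgA xy1 sx sx'.
Qed.

Lemma sgM_assoc x y z : sgM x y -> sgM y z -> sg y != [::] ->
  sg (x * (y * z)) = sg x ++ sg y ++ sg z.
Proof.
move En: (sg x) => s; elim: s x En => [|e s IH] x Ex xy yz ny.
  by have [a ->] := sg_nil m0 Ex; rewrite sg_iotal // yz.
have [a [x' [xE sx']]] := sg_cons m0 Ex.
have sx : sg (ap e * x') = e :: sg x' by rewrite sx' -Ex xE sg_iotal.
have xy' : sgM x' y.
  by apply: (sgM_consl _ sx); move: xy; rewrite /sgM xE -!mulgA !sg_iotal.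
have IH' := IH _ sx' xy' yz ny.
rewrite xE -!mulgA sg_iotal //.
case: (altP (sg x' =P [::])) => sx0.
  have [b bE] := sg_nil m0 sx0; move: xy; rewrite /sgM xE bE -sx' sx0.
  rewrite -!mulgA !sg_iotal // sg_iotar // sg_ap1 // => xy.
  rewrite [iota b * _]mulgA sgM_ap ?sg_iotal //.
  by rewrite /sgM -mulgA !sg_iotal.
rewrite sgM_ap //; last by rewrite /sgM IH' yz sx'.
by rewrite yz sx'.
Qed.

Lemma sgM_same x y s s' e : sg x = rcons s e -> sg y = e :: s' -> sgM x y.
Proof.
move=> sx sy; have [x1 [a [xE sx1]]] := sg_rcons m0 sx.
have [b [y1 [yE sy1]]] := sg_cons m0 sy.
rewrite /sgM sx sy cat_rcons xE yE -!mulgA [iota a * _]mulgA -iotaD.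
rewrite sg_junction ?sx1 ?sy1 //; last by left.
- by rewrite -sx xE sg_iotar.
- by rewrite -sy yE sg_iotal.
Qed.

Lemma sg_apr e x :
  sg (x * ap e) = rcons (sg x) e \/ sg x = rcons (sg (x * ap e)) (~~ e).
Proof.
have E (y : G) : sg y = rev (map negb (sg y^-1)) by rewrite -(sg_inv m0) invgK.
have Ey : (x * ap e)^-1 = ap (~~ e) * x^-1 by rewrite invgM apN.
case: (sg_ap m0 (~~ e) x^-1) => H; [left|right].
  by rewrite (E (x * ap e)) Ey H /= rev_cons -E negbK.
by rewrite (E x) H /= negbK rev_cons -Ey -E.
Qed.

Lemma sg_ap_size e x : (size (sg x) < size (sg (ap e * x)%g))%N ->
  sg (ap e * x) = e :: sg x.
Proof. by case: (sg_ap m0 e x) => // ->; rewrite /= ltnNge leqnSn. Qed.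

Lemma sg_apr_size e x : (size (sg x) < size (sg (x * ap e)%g))%N ->
  sg (x * ap e) = rcons (sg x) e.
Proof. by case: (sg_apr e x) => // ->; rewrite size_rcons ltnNge leqnSn. Qed.

Lemma leq_size_sg_apr e x : (size (sg (x * ap e)%g) <= (size (sg x)).+1)%N.
Proof.
by case: (sg_apr e x) => ->; rewrite size_rcons //; do 2!apply: leqW.
Qed.

(* Equivalently, x fixes a vertex of the tree. *)
Definition elliptic (x : G) : Prop := exists c y, x = c * iota y * c^-1.

Lemma elliptic_conj c x : elliptic x -> elliptic (c * x * c^-1).
Proof. by case=> d [y ->]; exists (c * d), y; rewrite invgM !mulgA. Qed.

Lemma elliptic_conjV c x : elliptic (c * x * c^-1) -> elliptic x.
Proof.
by move/(elliptic_conj c^-1); rewrite invgK -!mulgA mulKg mulVg mulg1.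
Qed.

Lemma sg_pow u n : sgM u u -> sg u != [::] ->
  size (sg (u ^+ n)) = (n * size (sg u))%N.
Proof.
move=> uu nu; case: n => [|n]; first by rewrite expg0 sg_1.
suff H : sgM u (u ^+ n) /\ size (sg (u ^+ n)) = (n * size (sg u))%N.
  by case: H => H1 H2; rewrite expgS H1 size_cat H2 mulSn.
elim: n => [|n [IH1 IH2]]; first by rewrite expg0 /sgM mulg1 sg_1 // cats0.
rewrite expgS /sgM sgM_assoc // IH1; split=> //.
by rewrite size_cat IH2 mulSn.
Qed.

(** Cyclic reduction: a conjugation moves the first letter to the end. If it cancels there, the
    length drops and induction applies; otherwise the conjugate [u] is cyclically reduced. *)
Lemma elliptic_or_hyperbolic h : elliptic h \/
  exists x, sg (x^-1 * h * x) != [::] /\ sgM (x^-1 * h * x) (x^-1 * h * x).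
Proof.
have [n] := ubnP (size (sg h)); elim: n h => // n IH h lt_n.
case E : (sg h) => [|e s].
  by left; have [y ->] := sg_nil m0 E; exists 1, y; rewrite invg1 mulg1 mul1g.
have [z [w [hE sw]]] := sg_cons m0 E.
pose w1 := w * iota z; pose u := w1 * ap e; pose c := iota z * ap e.
have hc : h = c * u * c^-1.
  by rewrite /u /c /w1 invgM hE !mulgA mulgK mulgK.
have cu : c^-1 * h * c = u by rewrite hc conj_conjV.
have sw1 : sg w1 = s by rewrite sg_iotar.
have saw : sg (ap e * w1) = e :: sg w1.
  by rewrite sw1 mulgA sg_iotar // -E hE sg_iotal.
case: (sg_apr e w1) => su; last first.
  have lt_u : (size (sg u) < n)%N.
    rewrite E /= -sw1 su size_rcons ltnS in lt_n; exact: ltnW lt_n.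
  have [eu|[x [nx ux]]] := IH u lt_u.
    by left; rewrite hc; apply: elliptic_conj.
  right; exists (c * x); rewrite invgM (_ : _ * h * _ = x^-1 * u * x) //.
  by rewrite -cu !mulgA.
right; exists c; rewrite cu {1}/u su; split; first by case: (sg w1).
case: (altP (sg w1 =P [::])) => s0.
  by apply: (@sgM_same _ _ [::] [::] e); rewrite su s0.
rewrite /sgM {2}/u sgM_assoc ?su //.
- by rewrite sg_ap1 // cats1.
- by rewrite /sgM /u -mulgA sg_mul_ap // su cat_rcons.
- by rewrite /sgM su sg_ap1 // cats1.
Qed.

(** The powers of a cyclically reduced element grow linearly in length, whereas those of a conjugate
    of a base element stay shorter than the constant [N]. *)
Lemma elliptic_pow h n : (0 < n)%N -> elliptic (h ^+ n) -> elliptic h.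
Proof.
move=> n0 [c [y hE]]; case: (elliptic_or_hyperbolic h) => // -[x [nu uu]].
set u := x^-1 * h * x in nu uu.
pose w := x^-1 * c; pose N := (size (sg w) + size (sg w^-1)).+1.
have uE : u ^+ (n * N) = w * iota (N%:Z *: y)%R * w^-1.
  have uJ : u = h ^ x by rewrite /u conjgE mulgA.
  have J (a z : G) : a * z * a^-1 = z ^ a^-1 by rewrite conjgE invgK mulgA.
  rewrite uJ -conjXg expgnA hE iotaZ /= !J -conjXg -conjgM.
  by rewrite /w invgM invgK.
have /= := leq_size_sgM m0 (w * iota (N%:Z *: y)%R) w^-1.
rewrite -uE sg_pow // sg_iotar // leqNgt => /negP[].
rewrite -[X in (X <= _)%N]/N -mulnA mulnCA leq_pmulr // muln_gt0 n0.
by case: (sg u) nu.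
Qed.

Lemma elliptic_zexp h k : k != 0%R -> elliptic (zexp h k) -> elliptic h.
Proof.
case: k => [[|k]|k] // _; first exact: elliptic_pow.
rewrite /= => -[c [y hE]]; apply: (@elliptic_pow h k.+1) => //.
exists c, (- y)%R; rewrite iotaN -[LHS]invgK hE !invgM invgK; by rewrite mulgA.
Qed.

(** The geodesic from v to x y v lies in the union of those from v to x v and from x v to x y v; the
    second starts at height [aexp x]. *)
Lemma low_mulg h (x y : G) : low h (sg x) -> low (h - aexp x)%R (sg y) ->
  low h (sg (x * y)).
Proof.
move Es: (sg x) => s; elim: s x Es h => [|e s IH] x Es h.
  have [z ->] := sg_nil m0 Es; rewrite sg_iotal // aexp_iota // subr0.
  by [].
have [z [x' [xE sx']]] := sg_cons m0 Es.
rewrite xE aexp_iotal // aexp_ap // -mulgA sg_iotal // -mulgA /= => /andP[h0 ls].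
rewrite opprD addrA => /(IH _ sx' _ ls) lo.
have [E|E] := sg_ap m0 e (x' * y); first by rewrite E /= h0.
have : low (h - ht e)%R (~~ e :: sg (ap e * (x' * y))) by rewrite -E.
rewrite /= => /andP[_]; rewrite -addrA -opprD (_ : (ht e + _ = 0)%R) ?subr0 //.
by case: (e).
Qed.

(** The geodesic to x^-1 v is the reversed geodesic to x v, translated by x^-1, which lowers heights
    by [aexp x]. *)
Lemma low_invg h (x : G) : low h (sg x) -> low (h - aexp x)%R (sg x^-1).
Proof.
move Es: (sg x) => s; elim: s x Es h => [|e s IH] x Es h.
  by have [z ->] := sg_nil m0 Es; rewrite -iotaN !sg_iota // aexp_iota // subr0.
have [z [x' [xE sx']]] := sg_cons m0 Es.
rewrite xE aexp_iotal // aexp_ap // => /andP[h0 ls].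
have lo := IH _ sx' _ ls; have h1 := low_ge0 ls.
rewrite !invgM -iotaN sg_iotar //.
apply: low_mulg; first by rewrite opprD addrA.
rewrite -apN sg_ap1 // aexpV // opprK opprD addrA subrK /= h1.
by case: (e) h0 {h1 ls lo xE Es} => /=; rewrite /ht /=; lia.
Qed.

End Geometry.

(** * Stabilisers of components below a given height *)

Section LowGroup.
Variables (m : int) (r : nat -> int).
Hypothesis m0 : m != 0.
Local Notation pin := (pin m r).
Local Notation tr := (tr m r).
Local Notation G := (bst m r).
Local Notation iota := (@iota m r).
Local Notation ap := (@ap m r).
Local Open Scope group_scope.

(* The stabiliser of the component of v in the part of the tree of height at most 0. *)
Definition G0 (x : G) : bool := (aexp x == 0%R) && low 0 (sg x).

Lemma G0_mul x y : G0 x -> G0 y -> G0 (x * y).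
Proof.
move=> /andP[/eqP ex0 lx] /andP[/eqP ey0 ly]; rewrite /G0 aexpM // ex0 ey0 addr0 eqxx /=.
by apply: low_mulg; rewrite // ex0 subr0.
Qed.

Lemma G0_inv x : G0 x -> G0 x^-1.
Proof.
move=> /andP[/eqP ex0 lx]; rewrite /G0 aexpV // ex0 oppr0 eqxx /=.
by have := low_invg m0 lx; rewrite ex0 subr0.
Qed.

Lemma G0_iota y : G0 (iota y).
Proof. by rewrite /G0 aexp_iota // sg_iota. Qed.

Lemma G0_zexp x k : G0 x -> G0 (zexp x k).
Proof.
have G0X n : G0 x -> G0 (x ^+ n).
  move=> Gx; elim: n => [|n IH]; first by rewrite expg0 -(iota0 m r) G0_iota.
  by rewrite expgS G0_mul.
by case: k => n Gx; [apply: G0X | apply/G0_inv/G0X].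
Qed.

Lemma aexp_conj (x y : G) : aexp (x^-1 * y * x) = aexp y.
Proof. by rewrite !aexpM // aexpV // addrAC addNr add0r. Qed.

Lemma aexp_zexp (x : G) k : aexp (zexp x k) = (aexp x * k)%R.
Proof.
elim/int_rect: k => [|n IH|n IH]; first by rewrite aexp_1 // mulr0.
  by rewrite intS zexpS aexpM // IH mulrDr mulr1.
by rewrite intS opprD zexpB1 aexpM // aexpV // IH mulrDr mulrN1.
Qed.

Lemma first_exit (p : G) : ~~ low 0 (sg p) -> exists p1 p2,
  [/\ p = p1 * (ap false * p2), G0 p1, sg (ap false * p2) = false :: sg p2
    & sg p = sg p1 ++ false :: sg p2].
Proof.
move=> /(low_first_exit (lexx 0))[s1 [s2 [E l1 h1]]].
have [x1 [x2 [xE sx1 sx2]]] := sg_split m0 E.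
have [y [p2 [x2E sp2]]] := sg_cons m0 sx2.
exists (x1 * iota y), p2; split; rewrite ?sg_iotar //.
- by rewrite xE x2E !mulgA.
- by apply: G0_mul; rewrite ?G0_iota // /G0 /aexp sx1 l1 -[X in X == _]/(hgt s1) h1 eqxx.
- by rewrite sp2 -sx2 x2E sg_iotal.
- by rewrite sx1 sp2 E.
Qed.

(** The condition on z says that it moves the edge from v to a^e v, so nothing cancels around it. *)
Lemma sg_conj_iota e (p : G) z : sg (ap e * p) = e :: sg p -> ~~ pin (~~ e) z ->
  sg ((ap e * p)^-1 * iota z * (ap e * p)) = sg (ap e * p)^-1 ++ sg (ap e * p).
Proof.
move=> sp pz; have E : (ap e * p)^-1 = p^-1 * ap (~~ e) by rewrite invgM apN.
have sV : sg (p^-1 * ap (~~ e)) = rcons (sg p^-1) (~~ e).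
  by rewrite -E sg_inv // sp /= rev_cons -sg_inv.
rewrite E sV -!mulgA sg_junction ?sp //; last by right.
by rewrite cat_rcons.
Qed.

(** Outside E, the reduced form of x starts with a^-1 and ends with a, so equal signs meet at both
    junctions; inside E the last hypothesis excludes cancellation. *)
Lemma sg_conj_G0 (p x : G) : sg (ap false * p) = false :: sg p -> G0 x ->
  (forall z, x = iota z -> ~~ pin true z) ->
  sg ((ap false * p)^-1 * x * (ap false * p)) =
  sg (ap false * p)^-1 ++ sg x ++ sg (ap false * p).
Proof.
move=> sp /andP[/eqP ex0 lx] nx; set P := ap false * p.
have sV : sg P^-1 = rcons (sg p^-1) true by rewrite sg_inv // sp /= rev_cons -sg_inv.
case E : (sg x) => [|e s].
  have [z zE] := sg_nil m0 E; rewrite zE sg_conj_iota //; exact: nx.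
have ee := low0_first (eq_ind _ (fun t => low 0 t) lx _ E); subst e.
case/lastP E' : (sg x) => [|s' e']; first by rewrite E' in E.
have ee : e' = false.
  by apply: (@low0_last s'); rewrite -E' //; exact: ex0.
subst e'; rewrite -mulgA -E sgM_assoc ?E //.
- exact: sgM_same sV E.
- exact: sgM_same E' sp.
Qed.

(* An element fixing v and p1 p2 v fixes the geodesic between them. *)
Lemma geodesic_fix (p1 p2 : G) c : sgM p1 p2 ->
  (exists c', (p1 * p2)^-1 * iota c * (p1 * p2) = iota c') ->
  exists c', p1^-1 * iota c * p1 = iota c'.
Proof.
move Es: (sg p1) => s; elim: s p1 Es c => [|e s IH] p1 Es c p12 [c' cE].
  have [z ->] := sg_nil m0 Es; exists c.
  by rewrite -iotaN -!iotaD addrAC addNr add0r.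
have [y [q [pE sq]]] := sg_cons m0 Es.
have saq : sg (ap e * q) = e :: sg q by rewrite -(sg_iotal m0 y) -pE Es sq.
have qp2 : sgM q p2.
  by apply: (sgM_consl m0 _ saq); move: p12; rewrite /sgM pE -!mulgA !sg_iotal.
have saqp : sg (ap e * (q * p2)) = e :: sg (q * p2).
  by move: p12; rewrite /sgM pE -!mulgA !sg_iotal // saq qp2.
have cy (x : G) : (iota y * x)^-1 * iota c * (iota y * x) = x^-1 * iota c * x.
  rewrite invgM -[in RHS](_ : (iota y)^-1 * iota c * iota y = iota c) ?mulgA //.
  by rewrite -iotaN -!iotaD addrAC addNr add0r.
have pp : p1 * p2 = iota y * (ap e * (q * p2)) by rewrite pE -!mulgA.
have pc : pin (~~ e) c.
  apply: contraT => npc.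
  have := sg_conj_iota saqp npc.
  have -> : (ap e * (q * p2))^-1 * iota c * (ap e * (q * p2)) = iota c'.
    by rewrite -cE pp cy.
  by rewrite sg_iota // saqp; case: (sg _^-1).
have conj_ap : (ap e)^-1 * iota c * ap e = iota (tr (~~ e) c).
  by rewrite -apN (hnn m0 pc) apN mulgVK.
have [|c'' c''E] := IH q sq (tr (~~ e) c) qp2.
  by exists c'; rewrite -conj_ap -cE pp cy !invgM !mulgA.
by exists c''; rewrite -c''E -conj_ap pE cy !invgM !mulgA.
Qed.

(** Such a conjugation fixes the coordinate in Z[t, 1/t], which determines an element of E by
    [qpol_eq0]. *)
Lemma conj_iota_aexp0 (x : G) c c' : aexp x = 0%R -> x^-1 * iota c * x = iota c' ->
  c' = c.
Proof.
move=> x0 E; have := PcoordJ m0 x^-1 (aexp_iota r m0 c).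
rewrite invgK E aexpV // x0 oppr0 expr0z mul1r !Pcoord_iota // => /eqP.
rewrite tofrac_eq -subr_eq0 -qpolN -qpolD => /eqP/(qpol_eq0 m0)/eqP.
by rewrite subr_eq0 => /eqP.
Qed.

(** The geodesic from v to h v stays at height at most the length k of h. So h stabilises the
    component of a^k v below height k. *)
Lemma G0_exists_conj (h : G) : aexp h = 0%R -> exists x, G0 (x^-1 * h * x).
Proof.
move=> h0; pose k := size (sg h).
have exX n : aexp (ap false ^+ n) = n%:Z.
  by elim: n => [|n IH]; rewrite ?expg0 ?aexp_1 // expgS aexp_ap // IH -intS.
have lX n : low n%:Z (sg (ap false ^+ n)).
  elim: n => [|n IH]; first by rewrite expg0 sg_1.
  rewrite expgS; apply: low_mulg => //; first by rewrite sg_ap1.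
  by rewrite aexp_ap1 // intS addrC addrA addNr add0r.
exists (ap false ^+ k); rewrite /G0 aexp_conj h0 eqxx /=.
have lV : low 0 (sg (ap false ^+ k)^-1).
  by have := low_invg m0 (lX k); rewrite exX subrr.
apply: low_mulg => //; last first.
  by rewrite aexpM // aexpV // exX h0 addr0 opprK add0r lX.
by apply: low_mulg => //; rewrite aexpV // exX opprK add0r low_size.
Qed.

(* Half the translation distance bounds the depth of a component stabilised by h. *)
Lemma G0_conj_bound (h x : G) : ~ elliptic h -> G0 (x^-1 * h * x) ->
  (0 <= aexp x * 2 + (size (sg h))%:Z)%R.
Proof.
move=> nh Gy; have exE : aexp x = (- aexp (x^-1)%g)%R by rewrite aexpV // opprK.
case: (boolP (low 0 (sg x^-1))) => [/low_hgt|/first_exit[p1 [p2 [pE Gp1 sp _]]]].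
  by rewrite -[hgt _]/(aexp x^-1) exE => le0; lia.
set P := ap false * p2 in pE sp; pose y := p1^-1 * (x^-1 * h * x) * p1.
have Gy' : G0 y by apply: G0_mul => //; apply: G0_mul => //; apply: G0_inv.
have hE : h = P^-1 * y * P.
  have PE : P = p1^-1 * x^-1 by rewrite pE mulKg.
  by rewrite PE invgM invgK /y invgK -!mulgA !mulVKg mulgV mulg1.
(* Without cancellation, h has at least twice the length of [P], hence length at least 2 [aexp P] =
   -2 [aexp x]. *)
have sh := sg_conj_G0 sp Gy' _; rewrite -/P -hE in sh.
rewrite sh; last first.
  move=> z yz; case: nh; exists P^-1, z; by rewrite invgK hE yz.
rewrite !size_cat sg_inv // size_rev size_map exE pE aexpM //.
have /andP[/eqP-> _] := Gp1; rewrite add0r.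
have := hgt_size (sg P); rewrite -[hgt _]/(aexp P); lia.
Qed.

(** By [G0_conj_bound] the quantity [M] is nonnegative on the admissible x, so one of them minimises
    it. *)
Lemma G0_minimal_conj (h : G) : ~ elliptic h -> aexp h = 0%R ->
  exists x, G0 (x^-1 * h * x) /\
    forall z, G0 (z^-1 * (x^-1 * h * x) * z) -> (0 <= aexp z)%R.
Proof.
move=> nh h0; pose M (x : G) := (aexp x * 2 + (size (sg h))%:Z)%R.
pose P (n : nat) := `[< exists x, G0 (x^-1 * h * x) /\ M x = n%:Z >].
have exP : exists n, P n.
  have [x Gx] := G0_exists_conj h0; exists `|M x|%N; apply/asboolP.
  by exists x; split; rewrite // gez0_abs // G0_conj_bound.
case: (ex_minnP exP) => n /asboolP[x [Gx Mx]] n_min.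
exists x; split=> // z Gz.
have E : z^-1 * (x^-1 * h * x) * z = (x * z)^-1 * h * (x * z) by rewrite invgM !mulgA.
rewrite E in Gz; have Mxz := G0_conj_bound nh Gz.
have := n_min `|M (x * z)%g|%N; rewrite /P asboolT; last first.
  by exists (x * z); rewrite gez0_abs.
move=> /(_ isT); have : `|M (x * z)%g|%N%:Z = M (x * z) by rewrite gez0_abs.
by move: Mx; rewrite /M aexpM //; lia.
Qed.

Lemma G0_conj_nonelliptic (x y : G) : G0 x -> ~ elliptic y -> G0 y ->
  G0 (x^-1 * y * x) /\ (forall z, x^-1 * y * x = iota z -> ~~ pin true z).
Proof.
move=> Gx ny Gy; split; first by apply: G0_mul => //; apply: G0_mul => //; apply: G0_inv.
by move=> z E; case: ny; exists x, z; rewrite -E conjV_conj.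
Qed.

(* A non-elliptic h stabilises at most one component of a given height. *)
Lemma G0_commute (h k : G) : G0 h -> ~ elliptic h -> commute h k -> aexp k = 0%R ->
  G0 k.
Proof.
move=> Gh nh hk k0; rewrite /G0 k0 eqxx; apply: contraT => /first_exit.
case=> [p1 [p2 [kE Gp1 sp _]]]; set P := ap false * p2 in kE sp.
have [Gx nx] := G0_conj_nonelliptic Gp1 nh Gh.
have hE : P^-1 * (p1^-1 * h * p1) * P = h.
  have E (q : G) : q^-1 * (p1^-1 * h * p1) * q = (p1 * q)^-1 * (h * (p1 * q)).
    by rewrite invgM !mulgA.
  by rewrite E -kE hk mulKg.
have := sg_conj_G0 sp Gx nx; rewrite -/P hE => sh.
have P0 : aexp P = 0%R by move: k0; rewrite kE aexpM //; case/andP: Gp1 => /eqP-> _; rewrite add0r.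
(* The inverse of [P] is a prefix of the reduced form of h, so it stays low; having a-exponent 0,
   [P] stays low too, although its first letter goes up. *)
have /andP[_] := Gh; rewrite sh low_cat => /andP[lP _].
by have := low_invg m0 lP; rewrite aexpV // P0 oppr0 subr0 invgK sp => /low0_first.
Qed.

(* p would carry a stabilised component to one of smaller height, against [h_min]. *)
Lemma no_ascent (h p y y' : G) : ~ elliptic y -> G0 y -> commute h y' ->
  aexp h = 0%R -> (forall z, G0 (z^-1 * h * z) -> (0 <= aexp z)%R) ->
  aexp p = 1%R -> p^-1 * y * p = y' -> False.
Proof.
move=> ny Gy hy' h0 h_min p1E yE.
case: (boolP (low 0 (sg p))) => [/low_hgt|/first_exit[p1 [p2 [pE Gp1 sp _]]]].
  by rewrite -[hgt _]/(aexp p) p1E.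
set P := ap false * p2 in pE sp.
have [Gx _] := G0_conj_nonelliptic Gp1 ny Gy; set x := p1^-1 * y * p1 in Gx.
have nx : ~ elliptic x.
  by move=> ex; case: ny; rewrite -(conjV_conj p1 y); apply: elliptic_conj.
have xE : x = P * y' * P^-1.
  have E (q : G) : x = q * ((p1 * q)^-1 * y * (p1 * q)) * q^-1.
    by rewrite /x invgM -!mulgA mulgV mulg1 mulVKg.
  by rewrite -yE pE -E.
have P1 : aexp P = 1%R by move: p1E; rewrite pE aexpM //; case/andP: Gp1 => /eqP-> _; rewrite add0r.
have : G0 (P * h * P^-1).
  apply: (G0_commute Gx nx); last by rewrite (aexpM m0 (P * h)) (aexpM m0 P) aexpV // P1 h0.
  have E (q a b : G) : (q * a * q^-1) * (q * b * q^-1) = q * (a * b) * q^-1.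
    by rewrite -!mulgA mulKg.
  by rewrite /commute xE !E hy'.
rewrite -{1}[P]invgK => /h_min; by rewrite aexpV // P1.
Qed.

Lemma elliptic_of_commute (h g : G) k : k != 0%R -> aexp h = 0%R ->
  (aexp g == 1%R) || (aexp g == -1)%R -> commute h (g * zexp h k * g^-1) -> elliptic h.
Proof.
move=> k0 h0 exg hg; apply: contrapT => nh.
have [x [Gh1 h_min]] := G0_minimal_conj nh h0.
pose h1 := x^-1 * h * x; pose g1 := x^-1 * g * x.
have nh1 : ~ elliptic h1.
  by move=> e1; case: nh; rewrite -(conjV_conj x h); apply: elliptic_conj.
have zJ : zexp h1 k = x^-1 * zexp h k * x.
  by rewrite /h1 -!mulgA -!conjgE zexpJ.
pose k1 := g1 * zexp h1 k * g1^-1.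
have k1E : k1 = x^-1 * (g * zexp h k * g^-1) * x.
  by rewrite /k1 zJ /g1 !invgM invgK -!mulgA !mulVKg.
have hk1 : commute h1 k1.
  have E (q a b : G) : (q^-1 * a * q) * (q^-1 * b * q) = q^-1 * (a * b) * q.
    by rewrite -!mulgA mulVKg.
  by rewrite /commute k1E /h1 !E hg.
have h10 : aexp h1 = 0%R by rewrite aexp_conj.
have Gk1 : G0 k1.
  apply: (G0_commute Gh1 nh1 hk1).
  by rewrite k1E aexp_conj !aexpM // aexpV // addrAC subrr add0r aexp_zexp h0 mul0r.
have nz1 : ~ elliptic (zexp h1 k) by move/(elliptic_zexp m0 k0).
have nk1 : ~ elliptic k1 by move=> ek; apply: nz1; apply: (@elliptic_conjV _ _ g1).
have exg1 : aexp g1 = aexp g by rewrite aexp_conj.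
(* [no_ascent] needs a conjugator of a-exponent 1: this is [g1] or its inverse, and in the second
   case [k1] and [zexp h1 k] exchange roles. *)
case/orP: exg => /eqP eg.
  apply: (@no_ascent h1 g1 k1 (zexp h1 k)); rewrite ?exg1 //.
    exact/commute_zexp/commute_refl.
  by rewrite /k1 conj_conjV.
apply: (@no_ascent h1 g1^-1 (zexp h1 k) k1); rewrite ?aexpV ?exg1 ?eg //.
  exact: G0_zexp.
by rewrite invgK.
Qed.

End LowGroup.

(** * Endomorphisms fixing the base group *)

Section FixBase.
Variables (m : int) (r : nat -> int).
Hypothesis m0 : m != 0.
Local Notation pin := (pin m r).
Local Notation tr := (tr m r).
Local Notation G := (bst m r).
Local Notation iota := (@iota m r).
Local Notation ap := (@ap m r).
Local Open Scope group_scope.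

Lemma G0_decomp (w : G) : G0 (ap true * w) -> sg (ap true * w) = true :: sg w ->
  exists u w', [/\ w = u * (ap false * w'), G0 u, G0 w' & sg w = sg u ++ false :: sg w'].
Proof.
move=> /andP[/eqP ew lw] sw.
have [|s1 [s2 [E [l1 h1] [l2 h2]]]] := low0_decomp lw ew; first by rewrite sw.
move: E; rewrite sw => -[E].
have [x1 [x2 [wE sx1 sx2]]] := sg_split m0 E.
have [y [w' [x2E sw']]] := sg_cons m0 sx2.
have sx1y : sg (x1 * iota y) = s1 by rewrite sg_iotar.
exists (x1 * iota y), w'; rewrite /G0 /aexp sx1y sw'.
rewrite -/(hgt s1) -/(hgt s2) h1 h2 l1 l2; split=> //.
by rewrite wE x2E !mulgA.
Qed.

Lemma G0_start (w : G) : G0 w -> sg w != [::] -> exists z w1,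
  [/\ w = iota z * (ap true * w1), G0 (ap true * w1) & sg (ap true * w1) = true :: sg w1].
Proof.
move=> Gw nw; case E : (sg w) nw => [//|e s] _; have [z [w1 [wE sw1]]] := sg_cons m0 E.
have /andP[_ lw] := Gw; have ee := low0_first (eq_ind _ (fun t => low 0 t) lw _ E).
subst e; exists z, w1.
have w1E : ap true * w1 = iota (- z)%R * w by rewrite wE iotaN mulKg.
by split; rewrite // w1E; [apply: G0_mul; rewrite ?G0_iota | rewrite sg_iotal // E sw1].
Qed.

Lemma G0_ind (Q : G -> Prop) : (forall y, Q (iota y)) ->
  (forall z u w, Q u -> Q w -> Q (iota z * (ap true * (u * (ap false * w))))) ->
  forall w, G0 w -> Q w.
Proof.
move=> QE QS w; have [n] := ubnP (size (sg w)); elim: n w => // n IH w lt_n Gw.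
case: (altP (sg w =P [::])) => [/(sg_nil m0)[y ->]//|nw].
have [z [w1 [wE Gw1 sw1]]] := G0_start Gw nw.
have [u [w' [w1E Gu Gw' sE]]] := G0_decomp Gw1 sw1.
have : size (sg w) = (size (sg u) + size (sg w')).+2.
  by rewrite wE sg_iotal // sw1 sE /= size_cat /= addnS.
move=> sz; rewrite sz ltnS in lt_n; rewrite wE w1E; apply: QS; apply: IH => //; lia.
Qed.

Variable F : G -> G.
Hypothesis FM : {morph F : x y / x * y}.
Hypothesis FE : forall y, F (iota y) = iota y.
Hypothesis Fa : aexp (F (ap false)) = 1%R.
Let g := F (ap false).

Lemma g_conj y : pin false y -> g * iota y * g^-1 = iota (tr false y).
Proof.
by move=> py; rewrite -[iota y]FE -FM (hnn m0 py) FM FE mulgK.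
Qed.

Lemma gV_conj y : pin true y -> g^-1 * iota y * g = iota (tr true y).
Proof.
by move=> py; rewrite -(hom_V FM) -[iota y]FE -FM (hnn m0 py) FM FE -mulgA -FM mulVg (hom_1 FM) mulg1.
Qed.

(** Otherwise the geodesic to g^-1 v leaves upwards at p1 v. As g conjugates m e_0 into E, m e_0
    fixes g^-1 v, hence p1 v and the edge after it. Seen from p1 v it is still m e_0
    ([conj_iota_aexp0]), which is not in E_1. *)
Lemma low_gV : low 0 (sg g^-1).
Proof.
apply: contraT => /first_exit[// | p1 [p2 [gE Gp1 sp sE]]].
set P := ap false * p2 in gE sp.
have pz : pin false m%:P%R by rewrite /pin lamC.
have E1 : (p1 * P)^-1 * iota m%:P%R * (p1 * P) = iota (tr false m%:P%R).
  by rewrite -gE invgK g_conj.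
have [|c cE] := geodesic_fix m0 (_ : sgM p1 P) (ex_intro _ _ E1).
  by rewrite /sgM -gE sE sp.
have ec : c = m%:P%R.
  by apply: (conj_iota_aexp0 m0 _ cE); case/andP: Gp1 => /eqP.
have npz : ~~ pin (~~ false) m%:P%R by rewrite /pin /= coefC.
have := sg_conj_iota m0 sp npz; rewrite -/P.
have -> : P^-1 * iota m%:P%R * P = iota (tr false m%:P%R).
  have E (q : G) : q^-1 * (p1^-1 * iota m%:P%R * p1) * q = (p1 * q)^-1 * iota m%:P%R * (p1 * q).
    by rewrite invgM !mulgA.
  by rewrite -E1 -E cE ec.
by rewrite sg_iota // sp; case: (sg P^-1).
Qed.

(** By [low_gV], the map x |-> g^-1 x g sends [G0] into itself; the rest is induction along first
    returns. *)
Lemma F_G0 w : G0 w -> G0 (F w).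
Proof.
elim/G0_ind => {w} [y|z u w Gu Gw]; first by rewrite FE G0_iota.
have -> : F (iota z * (ap true * (u * (ap false * w)))) =
    iota z * (g^-1 * F u * g * F w).
  by rewrite !FM FE (hom_V FM (ap false)) -/g !mulgA.
apply: G0_mul; rewrite ?G0_iota //; apply: G0_mul => //.
have /andP[/eqP eu lu] := Gu; rewrite /G0 aexp_conj // eu eqxx /=.
have egV : aexp g^-1 = (-1)%R by rewrite aexpV // Fa.
apply: low_mulg => //; last first.
  have := low_invg m0 low_gV; rewrite invgK aexpM // eu addr0; exact.
apply: low_mulg => //; first exact: low_gV.
by rewrite egV; apply: low_mono lu.
Qed.

Lemma gV_start : exists s, sg g^-1 = true :: s.
Proof.
have := low_gV; case E : (sg g^-1) => [|e s] l; last by exists s; rewrite (low0_first l).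
by move/eqP: Fa; rewrite -/g -[g]invgK aexpV // /aexp E big_nil oppr0.
Qed.

(** [g1] is the part of g before its path first rises above 0; the last letter is a because g^-1
    begins with a^-1. *)
Lemma g_decomp : exists g1 P y0,
  [/\ g = g1 * (P * ap false * iota y0), G0 g1, sgM g1 (P * ap false * iota y0),
      sg (P * ap false) = rcons (sg P) false
    & exists p2, P * ap false * iota y0 = ap false * p2 /\ sg (ap false * p2) = false :: sg p2].
Proof.
have : ~~ low 0 (sg g) by apply/negP => /low_hgt; rewrite -[hgt _]/(aexp g) Fa.
case/first_exit => // g1 [p2 [gE Gg1 sp sE]].
have sgg : sgM g1 (ap false * p2) by rewrite /sgM -gE sE sp.
have [s sV] := gV_start.
have : sg g = rcons (rev (map negb s)) false.
  by rewrite -[g]invgK sg_inv // sV /= rev_cons.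
case/lastP Ep : (sg (ap false * p2)) sE => [|t e]; first by rewrite Ep in sp.
rewrite -sp Ep -rcons_cat => -> /rcons_inj[_ ee]; subst e.
have [P [y0 [pE sP]]] := sg_rcons m0 Ep.
exists g1, P, y0; rewrite -pE; split=> //.
- by rewrite -(sg_iotar m0 _ y0) -pE Ep sP.
- by exists p2.
Qed.

(** Conjugating by [g1] stays in [G0], and conjugating by the rest of g causes no cancellation
    ([sg_conj_G0]), so its final letter survives on both sides. The element [y0] depends on g
    only. *)
Lemma g_conj_G0 : exists y0, forall x : G, G0 x -> (forall z, x = iota z -> ~~ pin true z) ->
  exists d, [/\ g^-1 * x * g = iota (- y0)%R * (ap true * d * ap false) * iota y0,
    sg (ap true * d) = true :: sg d
    & sg (ap true * d * ap false) = rcons (sg (ap true * d)) false].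
Proof.
have [g1 [P [y0 [gE Gg1 sgg sPa [p2 [pE sp]]]]]] := g_decomp.
exists y0 => x Gx nx; pose x1 := g1^-1 * x * g1.
have Gx1 : G0 x1 by apply: G0_mul => //; apply: G0_mul => //; apply: G0_inv.
(* A z in E_1 is conjugated into E by g^-1, so it fixes g v and hence g1 v. Then [g1] commutes with
   z, and x would itself be z. *)
have nx1 z : x1 = iota z -> ~~ pin true z.
  move=> zE; apply/negP => pz.
  have E1 : (g1 * (P * ap false * iota y0))^-1 * iota z * (g1 * (P * ap false * iota y0))
     = iota (tr true z) by rewrite -gE gV_conj.
  have [c' c'E] := geodesic_fix m0 sgg (ex_intro _ _ E1).
  have ec : c' = z by apply: (conj_iota_aexp0 m0 _ c'E); case/andP: Gg1 => /eqP.
  suff /nx : x = iota z by rewrite pz.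
  by rewrite -(conjV_conj g1 x) -/x1 zE -{1}ec -c'E conjV_conj.
have := sg_conj_G0 m0 sp Gx1 nx1; rewrite -pE => sE.
pose d := P^-1 * x1 * P; exists d.
have gxE : g^-1 * x * g = iota (- y0)%R * (ap true * d * ap false) * iota y0.
  by rewrite gE /d /x1 iotaN !invgM !mulgA.
(* Length count: [d] has length at most 2|P| + |x1|, and here it is 2 more, so both outer letters
   survive. *)
have sY : size (sg (ap true * d * ap false)) = ((size (sg P)).+1.*2 + size (sg x1))%N.
  have -> : ap true * d * ap false
     = iota y0 * ((P * ap false * iota y0)^-1 * x1 * (P * ap false * iota y0)) * iota (- y0)%R.
    by rewrite /d iotaN !invgM !mulgA mulgV mul1g mulgK.
  rewrite sg_iotar // sg_iotal // sE !size_cat sg_inv // size_rev size_map.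
  by rewrite sg_iotar // sPa size_rcons; lia.
have sd : (size (sg d) <= (size (sg P)).*2 + size (sg x1))%N.
  have := leq_size_sgM m0 (P^-1 * x1) P; have := leq_size_sgM m0 P^-1 x1.
  rewrite -/d sg_inv // size_rev size_map.
  by move=> H1 H2; apply: (leq_trans H2); rewrite -addnn addnAC leq_add2r; exact: H1.
have sd1 := leq_size_sg_ap m0 true d.
have sY2 := leq_size_sg_apr m0 false (ap true * d).
split=> //.
  apply: sg_ap_size => //; apply: leq_ltn_trans sd _.
  by move: sY2; rewrite sY doubleS !addSn ltnS.
apply: sg_apr_size => //; apply: leq_ltn_trans sd1 _.
by rewrite sY doubleS !addSn !ltnS.
Qed.

(** Induction along w = u a w'. The factor g^-1 F(u) g is y0^-1 a^-1 d a y0. If w' starts with z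
    a^-1, then F(w') starts with z y0^-1 a^-1; as E is abelian, y0 cancels and a z a^-1 remains,
    with z outside E_{m,xi}. So the leading a^-1 survives. *)
Lemma F_start : exists y0, forall w, G0 (ap true * w) ->
  sg (ap true * w) = true :: sg w ->
  exists d, F (ap true * w) = iota (- y0)%R * (ap true * d) /\
    sg (ap true * d) = true :: sg d.
Proof.
have [y0 conj_G0] := g_conj_G0; exists y0 => w.
have [n] := ubnP (size (sg w)); elim: n w => // n IH w lt_n Gw sw.
have [u [w' [wE Gu Gw' sE]]] := G0_decomp Gw sw.
have szw : size (sg w) = (size (sg u) + (size (sg w')).+1)%N by rewrite sE size_cat.
have lt_u : (size (sg u) < n)%N by rewrite szw in lt_n; lia.
have lt_w' : (size (sg w') < n)%N by rewrite szw in lt_n; lia.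
have npu z : u = iota z -> ~~ pin true z.
  move=> uE; apply/negP => pz; have : (size (sg (ap true * w)%g) <= size (sg w'))%N.
    by rewrite wE uE mulgA (hnn m0 pz) -mulgA mulKg sg_iotal.
  by rewrite sw /= szw; lia.
(* By the induction hypothesis F(u) lies in E only if u does, and then F(u) = u. *)
have npFu z : F u = iota z -> ~~ pin true z.
  case: (altP (sg u =P [::])) => [/(sg_nil m0)[z1 uE]|nu].
    by rewrite uE FE -uE; apply: npu.
  have [z1 [u1 [uE Gu1 su1]]] := G0_start Gu nu.
  have lt_u1 : (size (sg u1) < n)%N.
    by move: lt_u; rewrite uE sg_iotal // su1 /=; apply: ltnW.
  have [d [dE sd]] := IH u1 lt_u1 Gu1 su1.
  rewrite uE FM FE dE => /(congr1 (fun x => sg x)).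
  by rewrite !sg_iotal // sd sg_iota.
have [d [dE sd1 sd2]] := conj_G0 _ (F_G0 Gu) npFu.
have FwE : F (ap true * w) = iota (- y0)%R * (ap true * d * ap false) * iota y0 * F w'.
  by rewrite -dE wE !FM (hom_V FM (ap false)) -/g !mulgA.
case: (altP (sg w' =P [::])) => [/(sg_nil m0)[z w'E]|nw'].
  exists (d * (ap false * iota (y0 + z)%R)); split.
    by rewrite FwE w'E FE iotaD !mulgA.
  have E : sg (ap true * (d * (ap false * iota (y0 + z)%R))) = rcons (true :: sg d) false.
    by rewrite !mulgA sg_iotar // sd2 sd1.
  apply: sg_ap_size => //; rewrite E /= size_rcons ltnS mulgA sg_iotar //.
  exact: (leq_size_sg_apr m0 false d).
have [z [w2 [w'E Gw2 sw2]]] := G0_start Gw' nw'.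
have lt_w2 : (size (sg w2) < n)%N.
  by move: lt_w'; rewrite w'E sg_iotal // sw2 /=; apply: ltnW.
have [d2 [d2E sd2']] := IH w2 lt_w2 Gw2 sw2.
have npz : ~~ pin false z.
  apply/negP => pz; have : (size (sg w) <= size (sg u) + size (sg w2))%N.
    have -> : w = u * (iota (tr false z) * w2).
      by rewrite wE w'E; congr (_ * _); rewrite mulgA (hnn m0 pz) -mulgA mulVKg.
    by rewrite (leq_trans (leq_size_sgM m0 _ _)) // sg_iotal.
  by rewrite szw w'E sg_iotal // sw2 /=; lia.
pose d' := d * (ap false * (iota z * (ap true * d2))); exists d'.
have E : sg (ap true * d') = true :: sg d ++ false :: true :: sg d2.
  rewrite /d' [ap true * (d * _)]mulgA sg_junction //; last by right.
  by rewrite sd1.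
split.
  rewrite FwE w'E FM FE d2E /d' iotaN !mulgA -[_ * iota y0 * iota z]mulgA -iotaD.
  by rewrite [(y0 + z)%R]addrC iotaD !mulgA mulgK.
have le_d' : (size (sg d') <= size (sg d) + (size (sg d2)).+2)%N.
  rewrite (leq_trans (leq_size_sgM m0 _ _)) // leq_add2l.
  rewrite (leq_trans (leq_size_sg_ap m0 _ _)) // ltnS sg_iotal //.
  exact: (leq_size_sg_ap m0).
by apply: sg_ap_size => //; rewrite E /= size_cat ltnS.
Qed.

Lemma aexp_F x : aexp (F x) = aexp x.
Proof.
elim/(@bst_ind m r m0): x => [|z x IH|e x IH]; first by rewrite (hom_1 FM).
  by rewrite FM FE !aexp_iotal.
rewrite FM aexpM // IH aexp_ap //; congr (_ + _)%R; case: e => //.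
by rewrite (hom_V FM (ap false)) aexpV // Fa.
Qed.

Lemma fix_base_injective x : F x = 1 -> x = 1.
Proof.
move=> Fx; have x0 : aexp x = 0%R by rewrite -aexp_F Fx aexp_1.
have [c Gy] := G0_exists_conj m0 x0; set y := c^-1 * x * c in Gy.
have Fy : F y = 1 by rewrite /y !FM Fx mulg1 -FM mulVg (hom_1 FM).
have -> : x = c * y * c^-1 by rewrite /y conjV_conj.
case: (altP (sg y =P [::])) => [/(sg_nil m0)[z yE]|ny].
  by move: Fy; rewrite yE FE => ->; rewrite mulg1 mulgV.
have [z [w [yE Gw sw]]] := G0_start Gy ny; have [y0 H] := F_start.
have [d [dE sd]] := H w Gw sw.
move: Fy; rewrite yE FM FE dE => /(congr1 (fun x => sg x)).
by rewrite !sg_iotal // sd sg_1.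
Qed.

End FixBase.

(** * Surjective endomorphisms *)

Lemma divisor_Xn (u v : {poly int}) n : u * v = 'X^n ->
  exists j (s : int), (s == 1) || (s == -1) /\ v = s%:P * 'X^j.
Proof.
elim: n u v => [|n IH] u v.
  rewrite expr0 mulrC => uv; have : v \is a GRing.unit by apply/unitrPr; exists u.
  rewrite poly_unitE => /andP[/eqP/eq_leq/size1_polyC -> us].
  exists 0%N, v`_0; rewrite expr0 mulr1; split=> //.
  by move: us; rewrite coefC.
have Xdrop (w : {poly int}) : w`_0 = 0 -> w = 'X * drop_poly 1 w.
  move=> w0; apply/polyP => -[|i]; rewrite coefXM ?w0 //=.
  by rewrite coef_drop_poly addn1.
have XI (w w' : {poly int}) : 'X * w = 'X * w' -> w = w'.
  by apply: mulfI; rewrite polyX_eq0.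
move=> uv; have : u`_0 * v`_0 = 0 by rewrite -coef0M uv coefXn.
move/eqP; rewrite mulf_eq0 => /orP[] /eqP /Xdrop E; move: uv; rewrite E exprS.
  by rewrite -mulrA => /XI/IH.
rewrite mulrCA => /XI/IH[j [s [s1 ->]]]; exists j.+1, s; split=> //.
by rewrite exprS mulrCA.
Qed.

Lemma tK_exp_eq1 (k : int) : tK ^ k = 1 -> k = 0.
Proof.
have E n : tK ^+ n = 1 -> n = 0%N.
  move/eqP; rewrite /tK -tofracXn -tofrac1 tofrac_eq => /eqP/(congr1 (fun p : {poly int} => size p)).
  by rewrite size_polyXn size_poly1 => -[].
case: k => n; first by move/E->.
rewrite NegzE => /(congr1 GRing.inv); rewrite invr1 -exprnN invrK.
by move/E.
Qed.

Section Hopf.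
Variables (m : int) (r : nat -> int).
Hypothesis m0 : m != 0.
Local Notation pin := (pin m r).
Local Notation tr := (tr m r).
Local Notation G := (bst m r).
Local Notation iota := (@iota m r).
Local Notation ap := (@ap m r).
Local Notation "p %:K" := (@FracField.tofrac {poly int} p) (at level 2).
Local Open Scope group_scope.

(** The HNN relations express e_{i+1} by e_i, e_0 and a, so e_0 and a generate the group. *)
Lemma bst_gen (Q : G -> Prop) : Q 1 -> (forall x y, Q x -> Q y -> Q (x * y)) ->
  (forall x, Q x -> Q x^-1) -> Q (iota 1%R) -> Q (ap false) -> forall x, Q x.
Proof.
move=> Q1 QM QV Qb Qa.
have QA e : Q (ap e) by case: e => //; apply: (QV (ap false)).
have QZ x k : Q x -> Q (zexp x k).
  move=> Qx; elim/int_rect: k => [|n IH|n IH] //.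
    by rewrite intS zexpS; apply: QM.
  by rewrite intS opprD zexpB1; apply: QM => //; apply: QV.
have Qb' : Q (ge m r 0) by rewrite -iotaXn expr0.
have Qg i : Q (ge m r i).
  elim: i => [//|[|i] IH].
    have := hnn_base m r => /= /(congr1 (fun x => ga m r * x * (ga m r)^-1)).
    rewrite !mulgA mulgV mul1g mulgK => <-.
    by do 2!apply: (QM _ _ _ (QA true)) || apply: (QM _ _ (QA false)); apply: QZ.
  rewrite -hnn_step //; apply: (QM _ _ _ (QA true)); apply: (QM _ _ (QA false)).
  by apply: QM => //; apply: QZ.
have QE y : Q (iota y).
  elim/poly_int_ind: y => [|n y IH|n y IH]; first by rewrite iota0.
    by rewrite iotaD iotaXn; apply: QM.
  by rewrite iotaD iotaN iotaXn; apply: QM => //; apply: QV.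
by elim/(@bst_ind m r m0) => [|y x Qx|e x Qx] //; apply: QM.
Qed.

(** For |m| > 1, e_0 lies in neither associated subgroup, so v is its only fixed vertex, and
    whatever commutes with e_0 fixes v. *)
Lemma centralizer_b (x : G) : (1 < `|m|)%R -> commute x (iota 1%R) ->
  exists y, x = iota y.
Proof.
move=> m1 xb; case E : (sg x) => [|e s]; first exact: sg_nil.
have [z [x' [xE sx']]] := sg_cons m0 E.
have sx : sg (ap e * x') = e :: sg x' by rewrite sx' -E xE sg_iotal.
have pc : ~~ pin (~~ e) 1%R.
  case: e {E xE sx} => /=; rewrite /pin ?coefC // -[1%R]/(1%:P)%R lamC dvdz1.
  by lia.
have := sg_conj_iota m0 sx pc.
have -> : (ap e * x')^-1 * iota 1%R * (ap e * x') = iota 1%R.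
  have -> : ap e * x' = iota (- z)%R * x by rewrite xE iotaN mulKg.
  have E1 (c : G) : (c * x)^-1 * iota 1%R * (c * x) = x^-1 * (c^-1 * iota 1%R * c * x).
    by rewrite invgM !mulgA.
  by rewrite E1 -iotaN -!iotaD addrAC addNr add0r -xb mulKg.
by rewrite sg_iota // sx; case: (sg _^-1).
Qed.

(** Here E_{m,xi} = E, so positive powers of a move to the right past E. For large k this gives a^k
    x = y a^k' with k' = k + [aexp x] = k. *)
Lemma elliptic_absm1 (x : G) : `|m|%R = 1%R -> aexp x = 0%R -> elliptic x.
Proof.
move=> m1 x0.
have pf y : pin false y.
  rewrite /pin; apply/dvdzP; exists (lam r y * m)%R; rewrite -mulrA.
  by have : (m * m = 1)%R; [nia | move=> ->; rewrite mulr1].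
have aX k y : exists y', ap false ^+ k * iota y = iota y' * ap false ^+ k.
  elim: k y => [|k IH] y; first by exists y; rewrite mul1g mulg1.
  have [y' E] := IH y; exists (tr false y').
  by rewrite !expgS -mulgA E mulgA (hnn m0 (pf y')) -mulgA.
have [N HN] : exists N : nat, forall k : nat, (N <= k)%N -> exists y (k' : nat),
   (k' : int) = (k%:Z + aexp x)%R /\ ap false ^+ k * x = iota y * ap false ^+ k'.
  elim/(@bst_ind m r m0): x {x0} => [|z x [N IH]|e x [N IH]].
  - by exists 0%N => k _; exists 0%R, k; rewrite aexp_1 // addr0 iota0 mul1g mulg1.
  - exists N => k /IH[y [k' [kE E]]]; have [z' zE] := aX k z.
    exists (z' + y)%R, k'; rewrite aexp_iotal // mulgA zE -mulgA E iotaD mulgA; by split.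
  exists N.+1 => -[//|k] lt_k.
  have [k1 [k1N k1E k1P]] : exists k1 : nat, [/\ (N <= k1)%N, (k1 : int) = (k.+1%:Z + ht e)%R
      & ap false ^+ k.+1 * ap e = ap false ^+ k1].
    case: e; [exists k | exists k.+2]; rewrite /ht; split; try lia.
      by rewrite expgSr mulgK.
    by rewrite [RHS]expgSr.
  have [y [k' [kE E]]] := IH k1 k1N; exists y, k'; rewrite aexp_ap // mulgA k1P E; split=> //.
  by rewrite kE k1E addrA.
have [y [k' [kE E]]] := HN N (leqnn N).
move: kE E; rewrite x0 addr0 => -[->] E.
by exists (ap false ^- N), y; rewrite invgK -mulgA -E mulKg.
Qed.

Section Endomorphism.
Variable F : G -> G.
Hypothesis FM : {morph F : x y / x * y}.

Lemma aexp_hom x : aexp (F (iota 1%R)) = 0%R -> aexp (F x) = (aexp (F (ap false)) * aexp x)%R.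
Proof.
move=> Fb; elim/bst_gen: x => [|x y IHx IHy|x IH||].
- by rewrite (hom_1 FM) aexp_1 // mulr0.
- by rewrite FM !aexpM // IHx IHy mulrDr.
- by rewrite (hom_V FM) !aexpV // IH mulrN.
- by rewrite Fb aexp_iota // mulr0.
by rewrite aexp_ap1 // mulr1.
Qed.

Lemma hom_b_a_injective : F (iota 1%R) = iota 1%R -> aexp (F (ap false)) = 1%R ->
  forall x, F x = 1 -> x = 1.
Proof.
move=> Fb Fa.
have exF x : aexp (F x) = aexp x by rewrite aexp_hom ?Fa ?mul1r // Fb aexp_iota.
(* F preserves the coordinate of y in Z[t, 1/t]. This holds for e_0, is additive in y and passes
   through the HNN relation, hence holds on all of E. *)
pose T y := Pcoord (F (iota y)) = (qpol m r y)%:K.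
have TD y z : T y -> T z -> T (y + z)%R.
  by rewrite /T iotaD FM PcoordM // exF aexp_iota // expr0z mul1r qpolD tofracD => -> ->.
have TN y : T y -> T (- y)%R.
  rewrite /T iotaN (hom_V FM) PcoordV // exF aexp_iota // oppr0 expr0z mul1r qpolN tofracN.
  by move=> ->.
have Tphi y : pin false y -> T y -> T (tr false y).
  move=> py Ty; rewrite /T qpol_trK // -Ty.
  have -> : iota (tr false y) = ap false * iota y * (ap false)^-1 by rewrite (hnn m0 py) mulgK.
  by rewrite !FM (hom_V FM) PcoordJ ?exF ?aexp_iota ?aexp_ap1.
have T1 : T 1%R by rewrite /T Fb Pcoord_iota.
have TC k : T k%:P%R.
  elim/int_rect: k => [|n IH|n IH].
  - by rewrite /T polyC0 iota0 (hom_1 FM) Pcoord_1 // /qpol lin_ext0 tofrac0.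
  - by rewrite intS polyCD; apply: TD.
  - by rewrite intS opprD polyCD polyCN; apply: TD => //; apply: TN.
have TX i : T 'X^i%R.
  elim: i => [|[|i] IH]; first by rewrite expr0.
    rewrite (_ : 'X^1 = tr false m%:P)%R; first by apply: Tphi; rewrite ?/pin ?lamC.
    by rewrite /tr /phi lamC divzz m0 coefC /= -polyCD subrK mulr1 expr1.
  rewrite (_ : 'X^(i.+2) = tr false ('X^(i.+1) - (r i.+1)%:P))%R.
    apply: Tphi; first by rewrite /pin lamD lamN lamXn lamC subrr dvdz0.
    by apply: TD => //; apply: TN.
  rewrite /tr /phi lamD lamN lamXn lamC subrr div0z coefB coefXn coefC /= !sub0r opprK.
  by rewrite [(_%:P + _)%R]addrC subrK -exprS.
have TE y : T y.
  elim/poly_int_ind: y => [|n y Ty|n y Ty].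
  - exact: (TC 0%R).
  - exact: TD.
  - by apply: TD => //; apply: TN.
have [m1|] := ltP 1%R `|m|%R.
  apply: fix_base_injective => // y.
  have [y' E] : exists y', F (iota y) = iota y'.
    by apply: centralizer_b => //; rewrite -Fb /commute -!FM iotaC.
  have := TE y; rewrite /T E Pcoord_iota // => /eqP; rewrite tofrac_eq -subr_eq0.
  rewrite -qpolN -qpolD => /eqP/(qpol_eq0 m0)/eqP; rewrite subr_eq0 => /eqP->.
  by [].
move=> m1 x Fx; have am1 : `|m|%R = 1%R by lia.
have x0 : aexp x = 0%R by rewrite -exF Fx aexp_1.
have [c [y xE]] := elliptic_absm1 am1 x0.
have Fy : F (iota y) = 1.
  have -> : iota y = c^-1 * x * c by rewrite xE conj_conjV.
  by rewrite !FM Fx mulg1 -FM mulVg (hom_1 FM).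
have := TE y; rewrite /T Fy Pcoord_1 // => /esym/eqP; rewrite tofrac_eq0 => /eqP/(qpol_eq0 m0) y0.
by rewrite xE y0 iota0 mulg1 mulgV.
Qed.

End Endomorphism.

(** * The images of e_0 and a under a surjective endomorphism *)

Section Surjective.
Variable F : G -> G.
Hypothesis FM : {morph F : x y / x * y}.
Hypothesis Fsurj : forall y, exists x, F x = y.
Let h := F (iota 1%R).
Let g := F (ap false).

Lemma relation_h_g : commute h (g * zexp h m * g^-1).
Proof.
have pm : pin false m%:P%R by rewrite /pin lamC.
have E : ap false * zexp (iota 1%R) m * (ap false)^-1 = iota (tr false m%:P%R).
  by rewrite -iotaZ -mul_polyC mulr1 (hnn m0 pm) mulgK.
by rewrite /h /g -!hom_zexp // -(hom_V FM) // -!FM E /commute -!FM iotaC.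
Qed.

(** If k were nonzero, elements commuting with h would be determined in Z wr Z by their a-exponent.
    So g H g^-1 and H have the same image, and the image of every F(x) commutes with that of H
    (condition [C]). But e_0 commutes with no element of nonzero a-exponent there. *)
Lemma aexp_h : aexp h = 0%R.
Proof.
apply/eqP; apply: contraT => k0; set k := aexp h in k0.
pose H := zexp h m; pose A := Pcoord H.
have exH : aexp H = (k * m)%R by rewrite aexp_zexp.
have km0 : (k * m)%R != 0%R by rewrite mulf_neq0.
have cancel_k u v : ((1 - tK ^ k) * u = (1 - tK ^ k) * v)%R -> u = v.
  apply: mulfI; rewrite subr_eq0 eq_sym; apply: contra k0 => /eqP/tK_exp_eq1->.
  by rewrite eqxx.
have Pcomm (x y : G) : commute x y ->
    ((1 - tK ^ aexp x) * Pcoord y = (1 - tK ^ aexp y) * Pcoord x)%R.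
  move=> xy; have := PcoordM m0 y x; rewrite -xy PcoordM // => E.
  rewrite !mulrBl !mul1r; apply/eqP; rewrite subr_eq addrAC eq_sym subr_eq.
  by rewrite E.
have exk : aexp (g * H * g^-1) = aexp H by rewrite !aexpM // aexpV // addrAC subrr add0r.
have gH : Pcoord (g * H * g^-1) = A.
  apply: cancel_k; rewrite (Pcomm _ _ relation_h_g) (Pcomm h H); last first.
    exact/commute_zexp/commute_refl.
  by rewrite exk.
pose C (x : G) := ((1 - tK ^ aexp x) * A = (1 - tK ^ aexp H) * Pcoord x)%R.
have CF x : C (F x).
  elim/bst_gen: x => [|x y IHx IHy|x IH||].
  - by rewrite /C (hom_1 FM) // aexp_1 // Pcoord_1 // expr0z subrr mul0r mulr0.
  - rewrite /C FM aexpM // PcoordM // mulrDr -IHx mulrCA -IHy expfzDr ?tK_neq0 //.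
    by rewrite mulrA -mulrDl; congr (_ * _)%R; rewrite mulrBr mulr1 addrA subrK.
  - rewrite /C (hom_V FM) // aexpV // PcoordV // mulrN mulrCA -IH.
    rewrite mulrA -mulNr mulrBr mulr1 -expfzDr ?tK_neq0 // addNr expr0z.
    by rewrite opprB.
  - by apply: Pcomm; exact/commute_zexp/commute_refl.
  rewrite /C -/g; have := PcoordM m0 (g * H * g^-1) g.
  rewrite mulgVK PcoordM // exk gH -/A => E.
  by rewrite !mulrBl !mul1r; apply/eqP; rewrite subr_eq addrAC eq_sym subr_eq E.
have [x xE] := Fsurj (iota 1%R).
have := CF x; rewrite /C xE aexp_iota // expr0z subrr mul0r Pcoord_iota // => /esym/eqP.
rewrite qpol1 tofrac1 mulr1 subr_eq0 eq_sym exH => /eqP/tK_exp_eq1 E.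
by rewrite E eqxx in km0.
Qed.

Lemma aexp_g : (aexp g == 1%R) || (aexp g == -1)%R.
Proof.
have [x xE] := Fsurj (ap false); have := aexp_hom FM x aexp_h.
rewrite xE aexp_ap1 // -/g => /esym E.
have : (aexp g \is a GRing.unit)%R by apply/unitrPr; exists (aexp x).
by rewrite qualifE.
Qed.

Lemma elliptic_h : elliptic h.
Proof. exact: (elliptic_of_commute m0 m0 aexp_h aexp_g relation_h_g). Qed.

(** [I] describes the Z[t, 1/t]-multiples of [qpol p], and it contains the coordinate of every
    [B x]. By surjectivity it contains 1, so [qpol p] divides a power of t. *)
Lemma qpol_h p : h = iota p ->
  exists j (s : int), (s == 1%R) || (s == -1)%R /\ qpol m r p = (s%:P * 'X^j)%R.
Proof.
move=> hp; pose P0 := (qpol m r p)%:K.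
pose I v := exists (U : {poly int}) (N : nat), (tK ^+ N * v = U%:K * P0)%R.
have ID v w : I v -> I w -> I (v + w)%R.
  case=> U1 [N1 E1] [U2 [N2 E2]]; exists ('X^N2 * U1 + 'X^N1 * U2)%R, (N1 + N2)%N.
  rewrite tofracD !tofracM !tofracXn -/tK mulrDl -!mulrA -E1 -E2 mulrDr exprD.
  by rewrite -!mulrA; congr (_ + _)%R; rewrite mulrCA.
have IN v : I v -> I (- v)%R.
  by case=> U [N E]; exists (- U)%R, N; rewrite mulrN E tofracN mulNr.
have It v k : I v -> I (tK ^ k * v)%R.
  case=> U [N E]; case: k => n.
    exists ('X^n * U)%R, N; rewrite tofracM tofracXn -/tK -mulrA -E mulrCA.
    by [].
  exists U, (n.+1 + N)%N; rewrite NegzE -exprnN exprD mulrACA divff ?mul1r //.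
  by rewrite expf_neq0 // tK_neq0.
have I0 : I 0%R by exists 0%R, 0%N; rewrite mulr0 tofrac0 mul0r.
(* The power of g brings the a-exponent of F(x) to 0 and makes [B] trivial at a. *)
pose B (x : G) := F x * zexp g (- aexp x).
have exB x : aexp (B x) = 0%R.
  by rewrite /B aexpM // aexp_zexp // aexp_hom // ?aexp_h // mulrN subrr.
have BM x y : Pcoord (B (x * y)) = (Pcoord (B x) + tK ^ (aexp g * aexp x) * Pcoord (B y))%R.
  have -> : B (x * y) = B x * (zexp g (aexp x) * B y * (zexp g (aexp x))^-1).
    by rewrite /B FM aexpM // opprD addrC zexpD !zexpN -!mulgA mulKg.
  by rewrite PcoordM // exB expr0z mul1r PcoordJ // aexp_zexp.
have B1 : B 1 = 1 by rewrite /B (hom_1 FM) // aexp_1 // mul1g.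
have IB x : I (Pcoord (B x)).
  elim/bst_gen: x => [|x y IHx IHy|x IH||].
  - by rewrite B1 Pcoord_1.
  - by rewrite BM; apply: ID => //; apply: It.
  - have := BM x^-1 x; rewrite mulVg B1 Pcoord_1 // => /esym/eqP.
    by rewrite addr_eq0 => /eqP->; apply: IN; apply: It.
  - exists 1%R, 0%N; rewrite /B aexp_iota // oppr0 mulg1 -/h hp Pcoord_iota //.
  by rewrite /B aexp_ap1 // -/g /= expg1 mulgV Pcoord_1.
have [x xE] := Fsurj (iota 1%R).
have ex0 : aexp x = 0%R.
  have /eqP := aexp_hom FM x aexp_h; rewrite xE aexp_iota // eq_sym mulf_eq0 -/g.
  by case/orP: aexp_g => /eqP-> // /eqP.
have [U [N E]] := IB x.
apply: (@divisor_Xn U _ N); apply/eqP; rewrite -tofrac_eq tofracM -E tofracXn -/tK.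
by rewrite /B ex0 xE oppr0 mulg1 Pcoord_iota // qpol1 tofrac1 mulr1.
Qed.

End Surjective.

End Hopf.

(** * The Hopf property *)

Section Main.
Variables (m : int) (r : nat -> int).
Hypothesis m0 : m != 0.
Local Notation pin := (pin m r).
Local Notation tr := (tr m r).
Local Notation G := (bst m r).
Local Notation iota := (@iota m r).
Local Notation ap := (@ap m r).
Local Notation cls := (cls m r).
Local Open Scope group_scope.

(** For j > 0 the element p lies in E_1, and conjugating by a^-1 divides its image by t; for j = 0
    injectivity of [qpol] identifies p. *)
Lemma qpol_monomial_conj (p : {poly int}) (s : int) j : qpol m r p = (s%:P * 'X^j)%R ->
  exists c, iota p = c * iota s%:P%R * c^-1.
Proof.
elim: j p => [|j IH] p.
  rewrite expr0 mulr1 => /eqP; rewrite -[X in _ == X](qpolC m r s) -subr_eq0 -qpolN -qpolD.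
  move=> /eqP/(qpol_eq0 m0)/eqP; rewrite subr_eq0 => /eqP->.
  by exists 1; rewrite mul1g invg1 mulg1.
rewrite exprS mulrCA => qp.
have p0 : (p`_0 = 0)%R by rewrite -(coef0_qpol m r p) qp coefXM.
have pp : pin true p by rewrite /pin p0.
have qpsi : qpol m r (tr true p) = (s%:P * 'X^j)%R.
  by have := qpol_psi m r p0; rewrite qp; apply: mulfI; rewrite polyX_eq0.
have [c cE] := IH _ qpsi; exists (ap false * c).
have -> : iota p = ap false * iota (tr true p) * (ap false)^-1.
  have := hnn m0 (pin_tr pp); rewrite trK //= => ->; by rewrite mulgK.
by rewrite cE invgM !mulgA.
Qed.

Lemma hopfian (F : G -> G) : {morph F : x y / x * y} ->
  (forall y, exists x, F x = y) -> forall x, F x = 1 -> x = 1.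
Proof.
move=> FM Fsurj; have [c [p hE]] := elliptic_h m0 FM Fsurj.
have conjM (d x y : G) : d^-1 * (x * y) * d = d^-1 * x * d * (d^-1 * y * d).
  by rewrite -!mulgA mulVKg.
pose F1 x := c^-1 * F x * c.
have F1M : {morph F1 : x y / x * y} by move=> x y; rewrite /F1 FM conjM.
have F1surj y : exists x, F1 x = y.
  by have [x xE] := Fsurj (c * y * c^-1); exists x; rewrite /F1 xE conj_conjV.
have F1b : F1 (iota 1%R) = iota p by rewrite /F1 hE conj_conjV.
have [j [s [s1 qp]]] := qpol_h m0 F1M F1surj F1b.
have [d dE] := qpol_monomial_conj qp.
pose F2 x := d^-1 * F1 x * d.
have F2M : {morph F2 : x y / x * y} by move=> x y; rewrite /F2 F1M conjM.
have F2b : F2 (iota 1%R) = iota s%:P%R by rewrite /F2 F1b dE conj_conjV.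
have exF2 x : aexp (F2 x) = (aexp (F2 (ap false)) * aexp x)%R.
  by apply: aexp_hom; rewrite // F2b aexp_iota.
have F2surj y : exists x, F2 x = y.
  by have [x xE] := F1surj (d * y * d^-1); exists x; rewrite /F2 xE conj_conjV.
have sqr1 (k : int) : (k == 1%R) || (k == -1)%R -> (k * k = 1)%R by case/orP => /eqP->.
(* [F2] maps e_0 to its s-th power with s = 1 or -1 and a to an element of a-exponent 1 or -1;
   squaring [F2] turns both signs into 1. *)
have F22M : {morph (fun x => F2 (F2 x)) : x y / x * y} by move=> x y; rewrite !F2M.
move=> x Fx; apply: (hom_b_a_injective m0 F22M); last first.
- by rewrite [F2 x](_ : _ = 1) ?hom_1 // /F2 /F1 Fx mulg1 mulVg mulg1 mulVg.
- by rewrite exF2 sqr1 // (aexp_g m0 F2M F2surj).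
rewrite F2b -[s%:P%R]mulr1 mul_polyC iotaZ hom_zexp // F2b -iotaZ -mul_polyC -polyCM.
by rewrite sqr1.
Qed.

(** * Back to words *)

Section Transfer.
Variable f : word -> word.
Definition endo (x : G) : G := cls (f (wrepr x)).

Hypothesis fE : is_endo m r f.

Lemma endo_cls w : endo (cls w) = cls (f w).
Proof. by case: fE => fw _; apply/cls_eq/fw/wrepr_cls. Qed.

Lemma endoM : {morph endo : x y / x * y}.
Proof.
move=> x y; rewrite -[x]wreprK -[y]wreprK -cls_cat !endo_cls -cls_cat.
by case: fE => _ fM; apply/cls_eq/fM.
Qed.

Lemma endo_inj : (forall x, endo x = 1 -> x = 1) -> endo_injective m r f.
Proof.
move=> inj u v /cls_eq; rewrite -!endo_cls => E; apply/cls_eq.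
apply/eqP; rewrite -divg_eq1; apply/eqP/inj.
by rewrite endoM (hom_V endoM) E mulgV.
Qed.

End Transfer.

Lemma bst_hopfian : BSt_hopfian m r.
Proof.
move=> f fE fsurj; apply: endo_inj => //; apply: (hopfian (endoM fE)) => y.
have [x /cls_eq xE] := fsurj (wrepr y).
by exists (cls x); rewrite endo_cls // xE wreprK.
Qed.

(** * Failure of the co-Hopf property *)

Let N : nat := `|m|%N.+1.

(* The endomorphism e_i |-> N e_i, a |-> a. *)
Definition stretch_letter (l : letter) : word :=
  if l.1 is GE _ then nseq N l else [:: l].
Definition stretch (w : word) : word := flatten (map stretch_letter w).

Lemma stretch_cat u v : stretch (u ++ v) = stretch u ++ stretch v.
Proof. by rewrite /stretch map_cat flatten_cat. Qed.

Lemma cls_stretchM u v : cls (stretch (u ++ v)) = cls (stretch u) * cls (stretch v).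
Proof. by rewrite stretch_cat cls_cat. Qed.

Lemma cls_stretch_inv w : cls (stretch (inv_word w)) = (cls (stretch w))^-1.
Proof.
elim: w => [|l w IH]; first by rewrite invg1.
rewrite /inv_word map_cons rev_cons -cats1 cls_stretchM IH.
rewrite -[l :: w]/([:: l] ++ w) cls_stretchM invgM; congr (_ * _).
rewrite -cls_inv /stretch /= !cats0; congr (cls _).
have E n x : nseq n (inv_letter x) = inv_word (nseq n x).
  by rewrite /inv_word map_nseq rev_nseq.
by case: l => -[//|i] b; rewrite -(E N).
Qed.

Lemma cls_stretch_pow w z : cls (stretch (pow_word w z)) = zexp (cls (stretch w)) z.
Proof.
have E n u : cls (stretch (flatten (nseq n u))) = cls (stretch u) ^+ n.
  by elim: n => [|n IH] //=; rewrite stretch_cat cls_cat IH expgS.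
by case: z => n; rewrite E // cls_stretch_inv expVgn.
Qed.

Lemma cls_stretch_we i : cls (stretch (we i)) = iota (N%:Z *: 'X^i)%R.
Proof.
rewrite iotaZ iotaXn /stretch /= cats0 /stretch_letter /=.
have E n : cls (nseq n (GE i, false)) = ge m r i ^+ n.
  by elim: n => [|n IH] //; rewrite [nseq _ _]/= cls_cons IH expgS.
exact: (E N).
Qed.

Lemma tr_stretch e y (n : nat) : pin e y ->
  pin e (n%:Z *: y)%R /\ tr e (n%:Z *: y)%R = (n%:Z *: tr e y)%R.
Proof.
move=> py; elim: n => [|n [IH1 IH2]]; first by rewrite !scale0r tr0 pin0.
rewrite intS !scalerDl !scale1r; split; first exact: pinD.
by rewrite trD // IH2.
Qed.

Lemma cls_stretch_relator R : relator m r R -> cls (stretch R) = 1.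
Proof.
have := cls_stretchM; have : cls (stretch wa) = ap false by [].
have := cls_stretch_we; have := cls_stretch_pow; have := cls_stretch_inv.
move: (fun w => cls (stretch w)) => ev evV evP evE evA evM.
case=> [i j||i i0]; rewrite !evM !evV ?evP !evE ?evA.
- by rewrite !mulgA (iotaC _ _ _ (_ *: 'X^j)%R) mulgK mulgV.
- have pm : pin false m%:P%R by rewrite /pin lamC.
  have [p1 p2] := tr_stretch N pm.
  rewrite -iotaZ scalerA mulrC -scalerA expr0 alg_polyC !mulgA (hnn m0 p1) p2 mulgK.
  by rewrite /tr /phi lamC divzz m0 coefC /= -polyCD subrK mulr1 expr1 mulgV.
have pX : pin false ('X^i - (r i)%:P)%R.
  by rewrite /pin lamD lamN lamC lamXn; case: i i0 => // i _; rewrite subrr dvdz0.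
have [p1 p2] := tr_stretch N pX.
rewrite -iotaZ scalerA mulrC -scalerA !mulgA -[_ * iota _ * iota _]mulgA -iotaD.
rewrite -scalerDr expr0 alg_polyC polyCN (hnn m0 p1) p2 mulgK.
rewrite /tr /phi lamD lamN lamC lamXn; case: i i0 {pX p1 p2} => // i _.
rewrite subrr div0z coefB coefXn coefC /= !sub0r opprK.
by rewrite [(_%:P + _)%R]addrC subrK -exprS mulgV.
Qed.

Lemma stretch_endo : is_endo m r stretch.
Proof.
split=> [u v uv|u v]; last by rewrite stretch_cat; apply: weq_refl.
apply/cls_eq; elim: uv => {u v} [//|u v _ ->//|u v w _ -> _ -> //|u v l|u v R rR].
- rewrite -[l :: _]/([:: l] ++ inv_word [:: l] ++ v) !(cls_stretchM u).
  by rewrite (cls_stretchM [:: l]) (cls_stretchM (inv_word _)) cls_stretch_inv mulVKg.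
by rewrite !(cls_stretchM u) (cls_stretchM R) (cls_stretch_relator rR) mul1g.
Qed.

Let Phi := endo stretch.
Let PhiM : {morph Phi : x y / x * y} := endoM stretch_endo.

Lemma Phi_iota y : Phi (iota y) = iota (N%:Z *: y)%R.
Proof.
have Pg i : Phi (iota 'X^i%R) = iota (N%:Z *: 'X^i)%R.
  by rewrite iotaXn /Phi (endo_cls stretch_endo) cls_stretch_we.
elim/poly_int_ind: y => [|n y IH|n y IH].
- by rewrite scaler0 iota0 (hom_1 PhiM).
- by rewrite iotaD PhiM IH Pg -iotaD scalerDr.
by rewrite iotaD iotaN PhiM (hom_V PhiM) IH Pg -iotaN -iotaD scalerBr.
Qed.

Lemma Phi_ap e : Phi (ap e) = ap e.
Proof.
have E : Phi (ap false) = ap false by rewrite /Phi (endo_cls stretch_endo).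
by case: e => //; rewrite (hom_V PhiM (ap false)) E.
Qed.

(** For E_1 this holds because N is nonzero, for E_{m,xi} because N = |m| + 1 is 1 modulo m. *)
Lemma pin_stretch e y : pin e (N%:Z *: y)%R -> pin e y.
Proof.
case: e; rewrite /pin; first by rewrite coefZ mulf_eq0.
have E (n : nat) : lam r (n%:Z *: y)%R = (n%:Z * lam r y)%R.
  elim: n => [|n IH]; first by rewrite scale0r mul0r /lam lin_ext0.
  by rewrite intS scalerDl scale1r lamD IH mulrDl mul1r.
rewrite E /N intS mulrDl mul1r rpredDr // dvdz_mulr //.
by rewrite dvdzE.
Qed.

(** By [pin_stretch], an element outside an associated subgroup stays outside after multiplication
    by N, so reduced forms go to reduced forms. *)
Lemma sg_Phi x : sg (Phi x) = sg x.
Proof.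
have [n] := ubnP (size (sg x)); elim: n x => // n IH x lt_n.
case E : (sg x) => [|e s].
  by have [y ->] := sg_nil m0 E; rewrite Phi_iota sg_iota.
have [z [x1 [xE s1]]] := sg_cons m0 E; rewrite E /= ltnS in lt_n.
rewrite xE !PhiM Phi_iota Phi_ap sg_iotal //.
case E1 : s => [|e1 s'].
  rewrite E1 in s1; have [y ->] := sg_nil m0 s1.
  by rewrite Phi_iota sg_iotar // sg_ap1.
rewrite E1 in s1; have [z1 [x2 [x1E s2]]] := sg_cons m0 s1.
rewrite E1 /= in lt_n.
have IH2 : sg (Phi x2) = sg x2 by apply: IH; rewrite s2; apply: ltnW.
have IH1 : sg (ap e1 * Phi x2) = e1 :: sg (Phi x2).
  have <- : Phi (ap e1 * x2) = ap e1 * Phi x2 by rewrite PhiM Phi_ap.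
  rewrite IH ?IH2; last by rewrite -(sg_iotal m0 z1) -x1E s1.
  by rewrite -(sg_iotal m0 z1) -x1E s1 s2.
rewrite x1E !PhiM Phi_iota Phi_ap sg_ap_iota_ap // ?IH2 ?s2 //.
case: (boolP (e1 == e)) => [/eqP|ne]; [by left | right].
apply/negP => /pin_stretch pz; have ee : e1 = ~~ e by case: (e) (e1) ne => -[].
have := congr1 size E; rewrite xE x1E sg_iotal // mulgA (hnn m0 pz) -mulgA ee apN mulVKg.
by rewrite sg_iotal // s2 E1 /=; lia.
Qed.

Lemma bst_not_cohopfian : BSt_not_cohopfian m r.
Proof.
exists stretch; split; first exact: stretch_endo.
  apply: (endo_inj stretch_endo) => x; rewrite -/Phi => Px.
  have : sg x = [::] by rewrite -sg_Phi Px sg_1.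
  case/(sg_nil m0) => y yE; move: Px; rewrite yE Phi_iota => /(congr1 (@Pcoord m r)).
  rewrite Pcoord_iota // Pcoord_1 // => /eqP; rewrite tofrac_eq0 => /eqP/(qpol_eq0 m0)/eqP.
  by rewrite scale_poly_eq0 /= => /eqP->; rewrite iota0.
(* By [sg_Phi] a preimage of e_0 would lie in E, and constant coefficients would give N y_0 = 1,
   although N >= 2. *)
move=> /(_ (we 0))[w /cls_eq wE].
have PE : Phi (cls w) = iota 1%R.
  by rewrite /Phi (endo_cls stretch_endo) wE; have := iotaXn m r 0; rewrite expr0.
have /(sg_nil m0)[y yE] : sg (cls w) = [::] by rewrite -sg_Phi PE sg_iota.
move: PE; rewrite yE Phi_iota => /(congr1 (@Pcoord m r)); rewrite !Pcoord_iota // => /eqP.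
rewrite tofrac_eq -subr_eq0 -qpolN -qpolD => /eqP/(qpol_eq0 m0)/eqP.
rewrite subr_eq0 => /eqP/(congr1 (fun p : {poly int} => p`_0)%R).
rewrite coefZ coefC /= => E.
have : (N%:Z %| 1)%Z by apply/dvdzP; exists (y`_0)%R; rewrite mulrC E.
by rewrite dvdz1 absz_nat eqSS absz_eq0 (negbTE m0).
Qed.

End Main.

Theorem theorem5p7 (m : int) (xi r : nat -> int) (s : nat -> nat -> int) :
  m != 0 -> padic m xi -> rs_spec m xi r s ->
  BSt_hopfian m r /\ BSt_not_cohopfian m r.
Proof. by move=> m0 _ _; split; [apply: bst_hopfian | apply: bst_not_cohopfian]. Qed.
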